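(* For any real matrix $A \in \mathbb{R}^{m \times n}$ with $m \geq n$, there is an $(n/4) \times n$ real matrix $V$ whose rows are orthogonal unit-length vectors, such that every row of $A(I - V^T V)$ has Euclidean norm at most $O(\operatorname{herdisc}(A) \lg(2m/n))$. Moreover, such a matrix $V$ can be computed in $O(mn^2 \lg(2 + m/n))$ time.
   Context: For a real matrix $A \in \mathbb{R}^{m \times n}$, its discrepancy is $\operatorname{disc}(A) = \min_{x \in \{-1,1\}^n} \|Ax\|_\infty$. The hereditary discrepancy $\operatorname{herdisc}(A)$ is the maximum of $\operatorname{disc}(A')$ over all submatrices $A'$ obtained from $A$ by deleting a subset of its columns. $I$ is the $n \times n$ identity matrix, and $\lg$ denotes the base-2 logarithm. The $O(\cdot)$ hides absolute constants. *)

(* Defs.v *)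
(* MathComp / MathComp-Analysis *)
From HB Require Import structures.
From mathcomp Require Import all_boot all_order all_algebra.
From mathcomp Require Import all_classical all_reals all_analysis.

Set Implicit Arguments.
Unset Strict Implicit.
Unset Printing Implicit Defensive.

Import Order.TTheory GRing.Theory Num.Theory.
Import numFieldNormedType.Exports.

Local Open Scope ring_scope.

Definition lg (R : realType) (x : R) : R := ln x / ln 2.

Definition l2norm (R : realType) (n : nat) (u : 'rV[R]_n) : R :=
  Num.sqrt (\sum_j u 0 j ^+ 2).

Definition coloring (R : realType) (n : nat) (s : {ffun 'I_n -> bool}) :
    'cV[R]_n :=
  \col_j (-1) ^+ s j.

(* The norm `|_| that MathComp-Analysis puts on matrices is the max norm.  The
   value given to \big[Num.min/_] is itself one of the minimized values, so
   this is the minimum over all colorings. *)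
Definition disc (R : realType) (m n : nat) (A : 'M[R]_(m, n)) : R :=
  \big[Num.min/ `|A *m coloring R [ffun=> false]| ]_(s : {ffun 'I_n -> bool})
     `|A *m coloring R s|.

(* S is the set of columns that are kept.  Since disc >= 0, the default value 0
   does not affect the maximum. *)
Definition herdisc (R : realType) (m n : nat) (A : 'M[R]_(m, n)) : R :=
  \big[Num.max/0]_(S : {set 'I_n})
     disc (colsub (fun k : 'I_#|S| => enum_val k) A).

Definition orthogonal_unit_rows (R : realType) (k n : nat)
    (V : 'M[R]_(k, n)) : Prop :=
  (forall i, l2norm (row i V) = 1) /\
  (forall i j, i != j -> \sum_l V i l * V j l = 0).

Definition rows_bounded (R : realType) (m k n : nat) (A : 'M[R]_(m, n))
    (V : 'M[R]_(k, n)) (b : R) : Prop :=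
  forall i, l2norm (row i (A *m (1%:M - V^T *m V))) <= b.

(* Real RAM.  A machine state has an integer memory and a real memory, each
   split into arrays: cell k of array a is addressed by (a, k).  Array names
   are literals in the program, so a program uses finitely many arrays; offsets
   are computed, which gives indirect addressing.  Scalar variables are arrays
   of which only cell 0 is used.  Programs are finite syntax, do not depend on
   the size of the input, and contain no real constants other than natural
   numbers; there is no conversion from reals to integers, and integers are
   only added, subtracted and compared, so that unit cost is reasonable.
   Integer subtraction is truncated, x / 0 = 0, and the square root of a
   negative number is 0. *)
Inductive iexp : Type :=
  | ILit of nat
  | IGet of nat & iexp
  | IAdd of iexp & iexp
  | ISub of iexp & iexp.

Inductive rexp : Type :=
  | RLit of nat
  | RGet of nat & iexp
  | RAdd of rexp & rexp
  | RSub of rexp & rexp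
  | RMul of rexp & rexp
  | RDiv of rexp & rexp
  | RSqrt of rexp.

Inductive bexp : Type :=
  | BLeI of iexp & iexp
  | BLeR of rexp & rexp
  | BNot of bexp
  | BAnd of bexp & bexp.

Inductive cmd : Type :=
  | Skip
  | ISet of nat & iexp & iexp      (* ISet a e v : cell e of array a := v *)
  | RSet of nat & iexp & rexp
  | Seq of cmd & cmd
  | If of bexp & cmd & cmd
  | While of bexp & cmd.

Record state (R : realType) : Type := State {
  imem : nat -> nat -> nat;
  rmem : nat -> nat -> R }.

Fixpoint ieval (R : realType) (s : state R) (e : iexp) : nat :=
  match e with
  | ILit c => c
  | IGet a e1 => imem s a (ieval s e1)
  | IAdd e1 e2 => (ieval s e1 + ieval s e2)%N
  | ISub e1 e2 => (ieval s e1 - ieval s e2)%N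
  end.

Fixpoint reval (R : realType) (s : state R) (e : rexp) : R :=
  match e with
  | RLit c => c%:R
  | RGet a e1 => rmem s a (ieval s e1)
  | RAdd e1 e2 => reval s e1 + reval s e2
  | RSub e1 e2 => reval s e1 - reval s e2
  | RMul e1 e2 => reval s e1 * reval s e2
  | RDiv e1 e2 => reval s e1 / reval s e2
  | RSqrt e1 => Num.sqrt (reval s e1)
  end.

Fixpoint beval (R : realType) (s : state R) (b : bexp) : bool :=
  match b with
  | BLeI e1 e2 => (ieval s e1 <= ieval s e2)%N
  | BLeR e1 e2 => reval s e1 <= reval s e2
  | BNot b1 => ~~ beval s b1
  | BAnd b1 b2 => beval s b1 && beval s b2
  end.

(* Evaluation time of an expression: one unit per node. *)
Fixpoint icost (e : iexp) : nat :=
  match e with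
  | ILit _ => 1
  | IGet _ e1 => (icost e1).+1
  | IAdd e1 e2 | ISub e1 e2 => (icost e1 + icost e2).+1
  end.

Fixpoint rcost (e : rexp) : nat :=
  match e with
  | RLit _ => 1
  | RGet _ e1 => (icost e1).+1
  | RAdd e1 e2 | RSub e1 e2 | RMul e1 e2 | RDiv e1 e2 =>
      (rcost e1 + rcost e2).+1
  | RSqrt e1 => (rcost e1).+1
  end.

Fixpoint bcost (b : bexp) : nat :=
  match b with
  | BLeI e1 e2 => (icost e1 + icost e2).+1
  | BLeR e1 e2 => (rcost e1 + rcost e2).+1
  | BNot b1 => (bcost b1).+1
  | BAnd b1 b2 => (bcost b1 + bcost b2).+1
  end.

Definition upd (T : Type) (f : nat -> nat -> T) (a k : nat) (v : T) :
    nat -> nat -> T :=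
  fun b l => if (b == a) && (l == k) then v else f b l.

Definition iset (R : realType) (s : state R) (a k v : nat) : state R :=
  State (upd (imem s) a k v) (rmem s).

Definition rset (R : realType) (s : state R) (a k : nat) (v : R) : state R :=
  State (imem s) (upd (rmem s) a k v).

(* exec c s t s' : started in s, the program c halts in s' after time t. *)
Inductive exec (R : realType) : cmd -> state R -> nat -> state R -> Prop :=
  | ESkip s : exec Skip s 1 s
  | EISet s a e v :
      exec (ISet a e v) s (icost e + icost v).+1
        (iset s a (ieval s e) (ieval s v))
  | ERSet s a e v :
      exec (RSet a e v) s (icost e + rcost v).+1
        (rset s a (ieval s e) (reval s v))
  | ESeq c1 c2 s s1 s2 t1 t2 :
      exec c1 s t1 s1 -> exec c2 s1 t2 s2 ->
      exec (Seq c1 c2) s (t1 + t2) s2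
  | EIfTrue b c1 c2 s s1 t1 :
      beval s b -> exec c1 s t1 s1 ->
      exec (If b c1 c2) s (bcost b + t1).+1 s1
  | EIfFalse b c1 c2 s s1 t1 :
      ~~ beval s b -> exec c2 s t1 s1 ->
      exec (If b c1 c2) s (bcost b + t1).+1 s1
  | EWhileTrue b c s s1 s2 t1 t2 :
      beval s b -> exec c s t1 s1 -> exec (While b c) s1 t2 s2 ->
      exec (While b c) s (bcost b + t1 + t2).+1 s2
  | EWhileFalse b c s :
      ~~ beval s b -> exec (While b c) s (bcost b).+1 s.

(* Real array a holds M in row-major order. *)
Definition stores (R : realType) (m n : nat) (s : state R) (a : nat)
    (M : 'M[R]_(m, n)) : Prop :=
  forall (i : 'I_m) (j : 'I_n), rmem s a (i * n + j)%N = M i j.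

(* Input: the dimensions in cells 0 and 1 of integer array 0, the entries in
   real array 0; the rest of the memory is arbitrary.  Output: real array 1. *)
Definition input (R : realType) (m n : nat) (A : 'M[R]_(m, n))
    (s : state R) : Prop :=
  [/\ imem s 0 0 = m, imem s 0 1 = n & stores s 0 A].

Definition output (R : realType) (k n : nat) (V : 'M[R]_(k, n))
    (s : state R) : Prop :=
  stores s 1 V.

(* Main.v *)
(* Greedily pivoted Gram-Schmidt on the rows of A gives the bound without the
   logarithmic factor.  Pick n / 4 rows, each of maximal residual norm, and let r
   be the largest residual norm left.  With h an upper bound of herdisc A, the
   matrix G = I + h^-2 * (sum of a^T a over the rows picked, and one more of
   residual norm r) has a determinant of at least (r / h)^(2 (n / 4 + 1)).

   Conversely, det G is at most exponential in n.  Rounding bit by bit with the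
   colorings of all subsets of the columns shows that, for M = 2^t, every class
   of Z^n modulo M contains a vector w with entries in [-M, M] and
   |A w| <= h M.  These M^n vectors each contribute at least exp (- O(n)) to the
   sum of exp (- w G w^T / M^2) over the integer vectors of the box, and this sum
   is O(M)^n / sqrt (det G), as for the corresponding Gaussian integral.  Hence
   r = O(h).

   To obtain orthonormal rows when the residuals of A vanish early, the program
   works on the rows of A followed by those of I; the latter are picked only when
   all residuals of A are zero. *)
Require Import Defs.
From HB Require Import structures.
From mathcomp Require Import all_boot all_order all_algebra.
From mathcomp Require Import all_classical all_reals all_analysis.
From mathcomp Require Import ring lra zify.

Set Implicit Arguments.
Unset Strict Implicit.
Unset Printing Implicit Defensive.

Import Order.TTheory GRing.Theory Num.Theory.
Import numFieldNormedType.Exports.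

Local Open Scope ring_scope.

(** * Gaussian sums over lattice points *)

(** The Gaussian is at most 1 / (1 + x^2), which is comparable to the derivative of the bounded
    increasing function x / (1 + |x|). *)
Lemma gauss_le_increment (R : realType) (d x : R) : 0 < d <= 1 ->
  d * expR (- x ^+ 2) <=
  4 * ((x + d) / (1 + `|x + d|) - x / (1 + `|x|)).
Proof.
move=> /andP[d0 d1].
have x2 : 0 < 1 + x ^+ 2 by rewrite ltr_wpDr// sqr_ge0.
apply: (@le_trans _ _ (d * (1 + x ^+ 2)^-1)).
  rewrite ler_pM2l// expRN lef_pV2 ?posrE ?expR_gt0//.
  exact: expR_ge1Dx.
have [x0|x0] := leP 0 x.
  rewrite !ger0_norm//; last lra.
  rewrite (_ : _ - _ = d / ((1 + x) * (1 + (x + d)))); last first.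
    by field; apply/andP; split; apply: lt0r_neq0; lra.
  have p : 0 < (1 + x) * (1 + (x + d)) by apply: mulr_gt0; lra.
  rewrite mulrCA ler_pM2l// ler_pdivlMr// mulrC ler_pdivrMr//.
  have h1 : 0 <= (1 - d) * (1 + x) by apply: mulr_ge0; lra.
  have := sqr_ge0 (x - 2^-1); nra.
have [xd|xd] := leP (x + d) 0.
  rewrite !ler0_norm//; last lra.
  rewrite (_ : _ - _ = d / ((1 - x) * (1 - (x + d)))); last first.
    by field; apply/andP; split; apply: lt0r_neq0; lra.
  have p : 0 < (1 - x) * (1 - (x + d)) by apply: mulr_gt0; lra.
  rewrite mulrCA ler_pM2l// ler_pdivlMr// mulrC ler_pdivrMr//.
  have h1 : 0 <= d * (1 - x) by apply: mulr_ge0; lra.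
  have := sqr_ge0 (x + 2^-1); nra.
(* Here x < 0 < x + d with d <= 1, so both denominators are at most 2 and the increment is at least
   d / 2. *)
rewrite (gtr0_norm xd) (ltr0_norm x0).
have h1 : (x + d) / 2 <= (x + d) / (1 + (x + d)).
  rewrite ler_pM2l// lef_pV2 ?posrE; lra.
have h2 : - x / 2 <= - (x / (1 - x)).
  rewrite -mulNr ler_pM2l ?oppr_gt0// lef_pV2 ?posrE; lra.
have h3 : d * (1 + x ^+ 2)^-1 <= d.
  by rewrite ger_pMr// invf_le1// lerDl sqr_ge0.
lra.
Qed.

(** The increments telescope, so the bound is uniform in [N] and in the shift [s]; 8 is 4 times the
    oscillation of a function with values in [-1, 1]. *)
Lemma gauss_sum_le (R : realType) (d s : R) (N : nat) : 0 < d <= 1 ->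
  \sum_(i < N) expR (- (d * (i%:R + s)) ^+ 2) <= 8 / d.
Proof.
move=> d01; have /andP[d0 d1] := d01.
rewrite ler_pdivlMr// mulr_suml.
pose g (x : R) := x / (1 + `|x|).
have g1 x : `|g x| <= 1.
  rewrite /g normrM normfV (ger0_norm (_ : 0 <= 1 + `|x|)) ?addr_ge0//.
  rewrite ler_pdivrMr ?mul1r ?lerDr// ltr_pwDl//.
have step (i : 'I_N) : true -> expR (- (d * (i%:R + s)) ^+ 2) * d <=
    4 * g (d * (i.+1%:R + s)) - 4 * g (d * (i%:R + s)).
  move=> _; rewrite mulrC -mulrBr.
  rewrite (_ : d * (i.+1%:R + s) = d * (i%:R + s) + d); last first.
    by rewrite -natr1; ring.
  exact: gauss_le_increment.
apply: (le_trans (ler_sum _ step)).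
rewrite -(big_mkord xpredT (fun i => 4 * g (d * (i.+1%:R + s)) -
   4 * g (d * (i%:R + s)))) telescope_sumr//.
have := g1 (d * (N%:R + s)); have := g1 (d * (0%:R + s)).
rewrite !ler_norml; lra.
Qed.

(** * Positive definite forms and their Schur complements *)

Definition qform (R : realType) n (H : 'M[R]_n) (w : 'rV[R]_n) : R :=
  (w *m H *m w^T) 0 0.

Definition posdef (R : realType) n (H : 'M[R]_n) : Prop :=
  H^T = H /\ forall w, w != 0 -> 0 < qform H w.

Section Schur.
Variables (R : realType) (n : nat) (H : 'M[R]_(1 + n)).
Hypothesis Hpd : posdef H.

Let a : R := H 0 0.
Let b : 'rV[R]_n := ursubmx H.
Definition schur : 'M[R]_n := drsubmx H - a^-1 *: (b^T *m b).

Lemma schur_blockE : H = block_mx a%:M b b^T (drsubmx H).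
Proof.
rewrite -{1}[H]submxK; congr block_mx.
  by apply/matrixP => i j; rewrite !mxE !ord1 eqxx mulr1n /a; congr (H _ _);
     apply/val_inj.
by rewrite /b trmx_ursub Hpd.1.
Qed.

Lemma posdef_pivot_gt0 : 0 < a.
Proof.
have /Hpd.2 : delta_mx 0 0 != 0 :> 'rV[R]_(1 + n).
  by apply/eqP => /matrixP/(_ 0 0); rewrite !mxE !eqxx => /eqP; rewrite oner_eq0.
by rewrite /qform -rowE trmx_delta -colE !mxE.
Qed.

Lemma qform_schur (x : R) (w : 'rV[R]_n) :
  qform H (row_mx x%:M w) = a * (x + a^-1 * (b *m w^T) 0 0) ^+ 2 + qform schur w.
Proof.
have a0 := lt0r_neq0 posdef_pivot_gt0.
rewrite /qform schur_blockE mul_row_block tr_row_mx mul_row_col /schur.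
set c := (b *m w^T) 0 0.
have bw : b *m w^T = c%:M by rewrite [LHS]mx11_scalar.
have wb : w *m b^T = c%:M by rewrite -[LHS]trmxK trmx_mul trmxK bw tr_scalar_mx.
rewrite !(mulmxBr, mulmxBl, mulmxDl) -scalemxAr -scalemxAl !mulmxA wb -!mulmxA bw.
rewrite !tr_scalar_mx -!scalar_mxM !mxE !eqxx !mulr1n.
by field.
Qed.

Lemma det_schur : \det H = a * \det schur.
Proof.
have a0 := lt0r_neq0 posdef_pivot_gt0.
have : block_mx 1%:M 0 (- (a^-1 *: b^T)) 1%:M *m H =
    block_mx a%:M b 0 schur :> 'M[R]_(1 + n).
  rewrite {1}schur_blockE mulmx_block !mul1mx !mul0mx !addr0; congr block_mx.
    by rewrite mulNmx -scalemxAl mul_mx_scalar scalerA mulVf// scale1r addNr.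
  by rewrite mulNmx -scalemxAl addrC.
move/(congr1 determinant); rewrite det_mulmx det_lblock !det1 !mul1r => ->.
by rewrite det_ublock det_scalar1.
Qed.

Lemma posdef_schur : posdef schur.
Proof.
split.
  rewrite /schur linearB /= linearZ /= trmx_mul trmxK trmx_drsub.
  by rewrite Hpd.1.
move=> w w0.
(* This first coordinate makes the square in [qform_schur] vanish. *)
have := Hpd.2 (row_mx (- (a^-1 * (b *m w^T) 0 0))%:M w).
rewrite qform_schur addNr expr0n mulr0 add0r; apply.
by rewrite row_mx_eq0 negb_and w0 orbT.
Qed.

(** Elimination keeps the diagonal at most 1, so that the square root of every pivot is an
    admissible step in [gauss_sum_le]. *)
Lemma schur_diag_le i : schur i i <= H (rshift 1 i) (rshift 1 i).
Proof.
rewrite !mxE big_ord1 !mxE gerDl oppr_le0 mulr_ge0 ?invr_ge0 ?sqr_ge0//.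
exact/ltW/posdef_pivot_gt0.
Qed.

End Schur.

(** Coordinate 0 becomes the inner sum, to be estimated with the other coordinates fixed. *)
Lemma sum_ffunS (R : realType) (J : finType) (n : nat)
    (F : {ffun 'I_n.+1 -> J} -> R) :
  \sum_f F f = \sum_(f : {ffun 'I_n -> J}) \sum_j
     F [ffun i => if unlift ord0 i is Some i' then f i' else j].
Proof.
rewrite pair_big /=.
pose g (p : {ffun 'I_n -> J} * J) : {ffun 'I_n.+1 -> J} :=
  [ffun i => if unlift ord0 i is Some i' then p.1 i' else p.2].
rewrite (reindex g)//=.
exists (fun f => ([ffun i => f (lift ord0 i)], f ord0)) => [[f j] _|f _] /=.
  congr (_, _); last by rewrite ffunE unlift_none.
  by apply/ffunP => i; rewrite !ffunE liftK.
apply/ffunP => i; rewrite ffunE.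
by case: unliftP => [i' ->|->] //=; rewrite ffunE.
Qed.

(** With [N = M + M] and [c = - M] these are the integer vectors with entries from - M to M - 1. *)
Definition box_vec (R : realType) (n N : nat) (c : R) (f : {ffun 'I_n -> 'I_N}) :
  'rV[R]_n := \row_j ((f j)%:R + c).

(* Completing the square in one variable at a time turns the lattice sum into
   a product of one-dimensional sums, one for each pivot of H. *)
Lemma gauss_lattice_sum_le (R : realType) (n N : nat) (c : R) (H : 'M[R]_n) :
  posdef H -> (forall i, H i i <= 1) ->
  0 < \det H /\
  \sum_(f : {ffun 'I_n -> 'I_N}) expR (- qform H (box_vec c f)) <=
    8 ^+ n / Num.sqrt (\det H).
Proof.
elim: n H => [|n IHn] H Hpd H1.
  rewrite det_mx00 sqrtr1 expr0 divr1; split=> //.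
  rewrite (eq_bigr (fun=> 1)) => [|f _].
    by rewrite sumr_const card_ffun !card_ord expn0.
  by rewrite /qform !mxE big_ord0 oppr0 expR0.
have a0 := posdef_pivot_gt0 Hpd.
have Spd := posdef_schur Hpd.
have [S0 SI] := IHn _ Spd (fun i => le_trans (schur_diag_le Hpd i) (H1 _)).
rewrite (det_schur Hpd); set a := H 0 0 in a0 *; set S := schur H in S0 SI *.
split; first exact: mulr_gt0.
rewrite sum_ffunS.
set d := Num.sqrt a.
have d0 : 0 < d by rewrite sqrtr_gt0.
have d1 : d <= 1 by rewrite -[leRHS]sqrtr1 ler_wsqrtr// H1.
rewrite sqrtrM ?(ltW a0)// -/d invfM mulrA exprS.
rewrite (_ : 8 * 8 ^+ n / d / _ = (8 ^+ n / Num.sqrt (\det S)) * (8 / d));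
  last by ring.
have d8 : 0 <= 8 / d by rewrite divr_ge0// ltW.
refine (le_trans _ (ler_wpM2r d8 SI)).
rewrite mulr_suml ler_sum// => f _.
(* Completing the square shifts the one-dimensional Gaussian by [u], which depends only on the other
   coordinates; [gauss_sum_le] allows any shift. *)
set u : R := a^-1 * (@ursubmx _ 1 n 1 n H *m (box_vec c f)^T) 0 0.
apply: (@le_trans _ _ (\sum_(j < N) expR (- qform S (box_vec c f)) *
    expR (- (d * (j%:R + (c + u))) ^+ 2))); last first.
  rewrite -mulr_sumr ler_pM2l ?expR_gt0//; apply: gauss_sum_le.
  by rewrite d0.
apply: ler_sum => j _.
set g := finfun _.
have -> : box_vec c g = row_mx (j%:R + c)%:M (box_vec c f).
  apply/rowP => i; rewrite !mxE ffunE.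
  case: splitP => i' e.
    rewrite ord1 !mxE eqxx mulr1n; case: unliftP => // i'' ei.
    by move: e; rewrite ei (ord1 i') lift0.
  rewrite !mxE (_ : i = lift ord0 i') ?liftK//.
  exact/val_inj.
rewrite (qform_schur Hpd) -/a -/S -/u -expRD ler_expR.
by rewrite exprMn sqr_sqrtr ?(ltW a0)// addrA [X in _ <= X]addrC opprD.
Qed.

(** * Rounding with colorings *)

(** The minimum defining [disc] is attained, and its value for the columns in [S] is one of those
    maximized in [herdisc]. *)
Lemma herdisc_coloring (R : realType) (m n : nat) (A : 'M[R]_(m, n))
    (S : {set 'I_n}) :
  exists s : 'I_n -> bool,
    forall i, `|\sum_(j in S) A i j * (-1) ^+ s j| <= herdisc A.
Proof.
pose B := colsub (fun k : 'I_#|S| => enum_val k) A.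
have [s Es] : exists s, disc B = `|B *m coloring R s|.
  rewrite /disc; elim/big_ind: _ => [|x y [s ->] [s' ->]|s _].
  - by exists [ffun=> false].
  - by rewrite /Num.min; case: ifP => _; [exists s|exists s'].
  - by exists s.
(* The coloring is indexed by ranks in [S]; it is carried back to column indices, with value [false]
   outside [S]. *)
exists (fun j => [exists k, (enum_val k == j) && s k]) => i.
rewrite (_ : \sum_(j in S) _ = (B *m coloring R s) i 0); last first.
  rewrite mxE big_enum_val; apply: eq_bigr => k _; rewrite !mxE.
  congr (_ * (-1) ^+ nat_of_bool _); apply/existsP/idP => [[k' /andP[/eqP/enum_val_inj ->]]//|sk].
  by exists k; rewrite eqxx.
apply: (@le_trans _ _ (disc B)).
  rewrite Es [leRHS]/Num.norm /= mx_normrE.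
  exact: (le_bigmax _ (fun ij => `|(B *m coloring R s) ij.1 ij.2|) (i, 0)).
exact: (le_bigmax _
  (fun S : {set 'I_n} => disc (colsub (fun k : 'I_#|S| => enum_val k) A)) S).
Qed.

Lemma herdisc_ge0 (R : realType) (m n : nat) (A : 'M[R]_(m, n)) : 0 <= herdisc A.
Proof. by rewrite /herdisc; apply/bigmax_geP; left. Qed.

(* Halving: the odd entries of y are made even by a coloring of their support,
   which costs h at this scale and h / 2, h / 4, ... at the next ones. *)
Lemma herdisc_rounding (R : realType) (m n : nat) (A : 'M[R]_(m, n)) (t : nat)
    (y : 'I_n -> nat) : (forall j, y j <= 2 ^ t)%N ->
  exists z : 'I_n -> bool, forall i,
    `|\sum_j A i j * ((y j)%:R - (2 ^ t)%:R * (z j)%:R)| <=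
      herdisc A * ((2 ^ t)%:R - 1).
Proof.
elim: t y => [|t IHt] y yt.
  (* At scale 1 every [y j] is 0 or 1 and is its own rounding. *)
  exists (fun j => odd (y j)) => i.
  rewrite big1 ?normr0 ?subrr ?mulr0// => j _.
  by move: (yt j); case: (y j) => [|[|]]//= _; rewrite mul1r subrr mulr0.
have [s hs] := herdisc_coloring A [set j | odd (y j)].
(* An odd [y j] is raised or lowered by 1 according to its color and then halved; an even one is
   halved exactly. *)
pose y' j := if odd (y j) && ~~ s j then uphalf (y j) else half (y j).
have [j|z hz] := IHt y'.
  move: (yt j); rewrite /y' expnS; case: ifP; lia.
exists z => i.
have -> : \sum_j A i j * ((y j)%:R - (2 ^ t.+1)%:R * (z j)%:R) =
  2 * (\sum_j A i j * ((y' j)%:R - (2 ^ t)%:R * (z j)%:R)) -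
  \sum_(j in [set j | odd (y j)]) A i j * (-1) ^+ s j.
  rewrite mulr_sumr [X in _ = _ - X]big_mkcond -sumrB /=; apply: eq_bigr => j _.
  rewrite inE expnS natrM.
  have -> : (y j)%:R = 2 * (y' j)%:R - (if odd (y j) then (-1) ^+ s j else 0) :> R.
    rewrite /y'; case: ifPn => [/andP[yo /negPf sj]|].
      rewrite yo sj expr0; apply/eqP; rewrite eq_sym subr_eq -natrM natr1 eqr_nat; lia.
    case: ifPn => [yo|yo _].
      rewrite /= negbK => ->; rewrite expr1 opprK -natrM natr1.
      by apply/eqP; rewrite eqr_nat; lia.
    by rewrite subr0 -natrM; apply/eqP; rewrite eqr_nat; lia.
  by case: ifP => _; ring.
(* The errors add up as 2 (2^t - 1) + 1 = 2^(t + 1) - 1. *)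
apply: (le_trans (ler_normB _ _)); rewrite normrM ger0_norm//.
have := hs i; have := hz i; rewrite expnS natrM; lra.
Qed.

(** * Gram determinants *)

Definition sqnorm (R : realType) n (u : 'rV[R]_n) : R := \sum_j u 0 j ^+ 2.

Lemma sqnormE (R : realType) n (u : 'rV[R]_n) : sqnorm u = (u *m u^T) 0 0.
Proof. by rewrite mxE; apply: eq_bigr => j _; rewrite mxE expr2. Qed.

Lemma sqnorm_ge0 (R : realType) n (u : 'rV[R]_n) : 0 <= sqnorm u.
Proof. by apply: sumr_ge0 => j _; exact: sqr_ge0. Qed.

Lemma sqnorm_eq0 (R : realType) n (u : 'rV[R]_n) : (sqnorm u == 0) = (u == 0).
Proof.
apply/idP/eqP => [|->].
  rewrite psumr_eq0 => [/allP u0|j _]; last exact: sqr_ge0.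
  apply/rowP => j; rewrite mxE; apply/eqP.
  by have := u0 j (mem_index_enum _); rewrite /= sqrf_eq0.
by rewrite /sqnorm big1// => j _; rewrite mxE expr0n.
Qed.

(** The scaling by [h^-2] makes each row contribute at most M^2 to the form at a vector w with |A w|
    <= h M. A list allows repetition: the extra row in [greedy_bound] may have been picked
    before. *)
Definition gram (R : realType) m n (A : 'M[R]_(m, n)) (h : R) (ps : seq 'I_m) :
  'M[R]_n := 1%:M + \sum_(p <- ps) h^-2 *: ((row p A)^T *m row p A).

Lemma qform_gram (R : realType) m n (A : 'M[R]_(m, n)) h ps w :
  qform (gram A h ps) w =
    sqnorm w + \sum_(p <- ps) (h^-1 * \sum_j A p j * w 0 j) ^+ 2.
Proof.
rewrite /qform /gram mulmxDr mulmxDl mulmx1 mxE -sqnormE; congr (_ + _).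
rewrite mulmx_sumr mulmx_suml summxE; apply: eq_bigr => p _.
rewrite -scalemxAr -scalemxAl mxE exprMn exprVn; congr (_ * _).
have e : row p A *m w^T = (\sum_j A p j * w 0 j)%:M.
  by rewrite [LHS]mx11_scalar !mxE; congr (_%:M); apply: eq_bigr => j _; rewrite !mxE.
have e' : w *m (row p A)^T = (\sum_j A p j * w 0 j)%:M.
  by rewrite -[LHS]trmxK trmx_mul trmxK e tr_scalar_mx.
by rewrite -!mulmxA e mulmxA e' -scalar_mxM mxE eqxx mulr1n expr2.
Qed.

Lemma gram_posdef (R : realType) m n (A : 'M[R]_(m, n)) h ps :
  posdef (gram A h ps).
Proof.
split.
  rewrite /gram linearD /= trmx1 linear_sum /=; congr (_ + _).
  by apply: eq_bigr => p _; rewrite linearZ /= trmx_mul trmxK.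
move=> w w0; rewrite qform_gram ltr_wpDr//.
  by apply: sumr_ge0 => p _; exact: sqr_ge0.
by rewrite lt_def sqnorm_eq0 w0 sqnorm_ge0.
Qed.

(** One lattice sum is bounded above by (8 M)^n / sqrt (det G) and below, through the rounded
    vectors, by M^n exp (- (n + size ps)); the powers of M cancel. *)
Lemma det_gram_le (R : realType) m n (A : 'M[R]_(m, n)) h ps :
  0 < h -> herdisc A <= h ->
  Num.sqrt (\det (gram A h ps)) <= 8 ^+ n * expR (n + size ps)%:R.
Proof.
move=> h0 Ah; set G := gram A h ps.
have G0 i : 0 <= G i i.
  rewrite !mxE eqxx addr_ge0// summxE sumr_ge0// => p _.
  by rewrite !mxE big_ord1 !mxE mulr_ge0 ?invr_ge0 ?exprn_ge0 ?(ltW h0)// sqr_ge0.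
(* A power of two above the diagonal of [G] makes the diagonal of G / M^2 at most 1, as
   [gauss_lattice_sum_le] requires. *)
have [t Gt] : exists t, forall i, G i i <= (2 ^ t)%:R.
  exists (Num.truncn (\sum_i G i i)).+1 => i.
  apply: (@le_trans _ _ (\sum_i G i i)).
    by rewrite (bigD1 i)//= lerDl sumr_ge0.
  apply: (le_trans (ltW (truncnS_gt _))); rewrite ler_nat ltnW//.
  exact: ltn_expl.
set M := (2 ^ t)%N in Gt.
have M0 : (0 < M)%N by rewrite expn_gt0.
have M0R : 0 < M%:R :> R by rewrite ltr0n.
have M1 : 1 <= M%:R :> R by rewrite ler1n.
pose H := M%:R^-2 *: G.
have qH w : qform H w = M%:R^-2 * qform G w.
  by rewrite /qform /H -scalemxAr -scalemxAl mxE.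
have Hpd : posdef H.
  split; first by rewrite linearZ /= (gram_posdef A h ps).1.
  by move=> w w0; rewrite qH mulr_gt0 ?invr_gt0 ?exprn_gt0// (gram_posdef A h ps).2.
have H1 i : H i i <= 1.
  rewrite mxE mulrC ler_pdivrMr ?exprn_gt0// mul1r (le_trans (Gt i))//.
  by rewrite expr2 ler_peMr// ltW.
have [dH] := gauss_lattice_sum_le (M + M) (- M%:R) Hpd H1.
rewrite detZ exprVn -exprM -[(2 * n)%N]mulnC exprM in dH *.
rewrite sqrtrM ?invr_ge0 ?exprn_ge0 ?(ltW M0R)// sqrtrV ?exprn_ge0 ?(ltW M0R)//.
rewrite sqrtr_sqr ger0_norm ?exprn_ge0 ?(ltW M0R)//.
rewrite pmulr_rgt0 ?invr_gt0 ?exprn_gt0// in dH.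
rewrite invfM invrK => upper.
have sG : 0 < Num.sqrt (\det G) by rewrite sqrtr_gt0.
have /choice[z hz] (y : {ffun 'I_n -> 'I_M}) : exists z : 'I_n -> bool, forall i,
    `|\sum_j A i j * ((y j)%:R - M%:R * (z j)%:R)| <= herdisc A * (M%:R - 1).
  exact: (herdisc_rounding A (fun j => ltnW (ltn_ord (y j)))).
(* The coordinate y - M z of the rounded vector, shifted by [M] into the index range of the box. *)
have gP (y : {ffun 'I_n -> 'I_M}) j : (y j + (if z y j then 0 else M) < M + M)%N.
  by have := ltn_ord (y j); case: (z y j); lia.
pose g y : {ffun 'I_n -> 'I_(M + M)} := [ffun j => Ordinal (gP y j)].
(* Reduction modulo [M] recovers [y]. *)
have g_inj : injective g.
  move=> y y' /ffunP e; apply/ffunP => j; apply: val_inj => /=.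
  have := congr1 val (e j); rewrite !ffunE /=.
  have := ltn_ord (y j); have := ltn_ord (y' j).
  by case: (z y j); case: (z y' j); lia.
have lower : (M ^ n)%:R * expR (- (n + size ps)%:R) <=
    \sum_(f : {ffun 'I_n -> 'I_(M + M)}) expR (- qform H (box_vec (- M%:R) f)).
  rewrite (bigID (mem (g @: [set: {ffun 'I_n -> 'I_M}]))) /=.
  apply: ler_wpDr; first by apply: sumr_ge0 => f _; exact: expR_ge0.
  rewrite big_imset /=; last by move=> y y' _ _; exact: g_inj.
  rewrite mulr_natl (_ : (M ^ n)%N = #|[set: {ffun 'I_n -> 'I_M}]|); last first.
    by rewrite cardsT card_ffun !card_ord.
  rewrite -sumr_const; apply: ler_sum => y _; rewrite ler_expR lerN2 qH.
  rewrite mulrC ler_pdivrMr ?exprn_gt0// qform_gram natrD mulrDl.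
  have wE j : box_vec (- M%:R) (g y) 0 j = (y j)%:R - M%:R * (z y j)%:R :> R.
    rewrite !mxE ffunE /=; case: (z y j); rewrite ?addn0 ?natrD /=; ring.
  (* Each coordinate is at most [M] in absolute value, and each row of [ps] contributes at most
     [M%:R ^+ 2] by the rounding. *)
  apply: lerD.
    rewrite /sqnorm mulr_natl -[X in _ <= _ *+ X](card_ord n) -sumr_const.
    apply: ler_sum => j _; rewrite wE.
    have yM : (y j)%:R <= M%:R :> R by rewrite ler_nat ltnW.
    have y0 : 0 <= (y j)%:R :> R by [].
    rewrite -[leLHS]real_normK ?num_real// lerXn2r ?nnegrE ?ler0n//.
    by case: (z y j); rewrite /= ?mulr1 ?mulr0 ler_norml; lra.
  rewrite mulr_natl (_ : _ *+ size ps = \sum_(p <- ps) M%:R ^+ 2); last first.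
    by rewrite big_const_seq count_predT iter_addr_0.
  apply: ler_sum => p _; rewrite -[leLHS]real_normK ?num_real// lerXn2r ?nnegrE ?ler0n//.
  rewrite normrM normfV (gtr0_norm h0) mulrC ler_pdivrMr//.
  under eq_bigr do rewrite wE.
  apply: (le_trans (hz y p)); rewrite mulrC.
  apply: ler_pM => //; [lra | exact: herdisc_ge0 | lra].
have := le_trans lower upper.
rewrite expRN natrX ler_pdivrMr ?expR_gt0//.
set X := expR _; set Y := Num.sqrt _ in sG *; set Z := M%:R ^+ n.
rewrite (_ : 8 ^+ n * (Z / Y) * X = Z * (8 ^+ n * X) / Y); last by ring.
by rewrite ler_pdivlMr// ler_pM2l// exprn_gt0.
Qed.

(** * Determinants under rank-one updates *)

(** Matrix determinant lemma: the same bordered matrix is made block triangular in two ways. *)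
Lemma det_1_rank1 (R : realType) n (x : 'cV[R]_n) (y : 'rV[R]_n) :
  \det (1%:M + x *m y) = 1 + (y *m x) 0 0.
Proof.
have [M eM] : exists M : 'M[R]_(1 + n), M = block_mx 1%:M (- y) x 1%:M.
  by eexists.
have e1 : \det M = \det (1%:M + x *m y).
  have : block_mx 1%:M 0 (- x) 1%:M *m M = block_mx 1%:M (- y) 0 (1%:M + x *m y).
    rewrite eM mulmx_block !mul1mx !mul0mx !addr0 mulmx1 addNr mulNmx mulmxN opprK.
    by rewrite addrC.
  by move/(congr1 determinant); rewrite det_mulmx det_lblock det_ublock !det1 !mul1r.
have e2 : \det M = \det (1%:M + y *m x).
  have : block_mx 1%:M y 0 1%:M *m M = block_mx (1%:M + y *m x) 0 x 1%:M.
    by rewrite eM mulmx_block !mul1mx !mul0mx !add0r mulmx1 addNr.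
  by move/(congr1 determinant); rewrite det_mulmx det_lblock det_ublock !det1 !mul1r mulr1.
by rewrite -e1 e2 [_ + _]mx11_scalar det_scalar1 !mxE eqxx.
Qed.

Lemma mulmx_tr_comm (R : realType) n (u v : 'rV[R]_n) : u *m v^T = v *m u^T.
Proof. by rewrite -[LHS]trmxK trmx_mul trmxK [X in X^T]mx11_scalar tr_scalar_mx -mx11_scalar. Qed.

Lemma posdef_unitmx (R : realType) n (G : 'M[R]_n) : posdef G -> G \in unitmx.
Proof.
move=> Gpd; rewrite -row_free_unit -kermx_eq0; apply/eqP/row_matrixP => i.
rewrite row0; apply/eqP; apply: contraT => /Gpd.2.
by rewrite /qform -row_mul mulmx_ker row0 mul0mx mxE ltxx.
Qed.

(* G acts as the identity on the part q of a orthogonal to the earlier rows, so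
   a G^-1 a^T is at least |q|^2. *)
Lemma det_rank1_update_ge (R : realType) n (G : 'M[R]_n) (c : R) (a q : 'rV[R]_n) :
  posdef G -> 0 < \det G -> 0 <= c -> q *m G = q -> (a - q) *m q^T = 0 ->
  \det G * (1 + c * sqnorm q) <= \det (c *: (a^T *m a) + G).
Proof.
move=> Gpd dG c0 qG aq.
have Gu := posdef_unitmx Gpd.
rewrite (_ : c *: (a^T *m a) + G = G *m (1%:M + (c *: (invmx G *m a^T)) *m a)); last first.
  by rewrite mulmxDr mulmx1 -scalemxAl -scalemxAr -mulmxA mulKVmx// addrC.
rewrite det_mulmx det_1_rank1 ler_pM2l// lerD2l -scalemxAr mxE.
apply: ler_wpM2l => //.
set p := a - q in aq.
have ea : a = q + p by rewrite addrC subrK.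
have GT : (invmx G)^T = invmx G by rewrite trmx_inv Gpd.1.
have qI : q *m invmx G = q by rewrite -{1}qG mulmxK.
have Iq : invmx G *m q^T = q^T by rewrite -{2}qI trmx_mul GT.
rewrite ea linearD /= mulmxDr Iq mulmxDl !mulmxDr aq add0r.
rewrite [q *m (_ *m _)]mulmxA qI mulmx_tr_comm aq addr0.
rewrite mxE -sqnormE lerDl mulmxA.
(* The cross terms are gone; what a G^-1 a^T has beyond |q|^2 is p G^-1 p^T, the value of the form
   of [G] at [u]. *)
set u := p *m invmx G.
have ep : p = u *m G by rewrite mulmxKV.
rewrite (_ : u *m p^T = u *m G *m u^T); last by rewrite {1}ep trmx_mul Gpd.1 mulmxA.
have [->|u0] := eqVneq u 0; first by rewrite !mul0mx mxE.
exact/ltW/Gpd.2.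
Qed.

(** * Greedy orthogonalization *)

(** For orthonormal vectors, the projection onto the orthogonal complement of the first [k] terms of
    the sequence. *)
Definition residual (R : realType) n (V : nat -> 'rV[R]_n) k : 'M[R]_n :=
  1%:M - \sum_(i < k) (V i)^T *m V i.

Definition greedy_row (R : realType) m n (A : 'M[R]_(m, n)) (E : 'M[R]_n)
    (q : 'rV[R]_n) : Prop :=
  (exists p, q = row p (A *m E) /\
     forall p', sqnorm (row p' (A *m E)) <= sqnorm q) \/
  (A *m E = 0 /\ exists p, q = row p E).

Definition greedy (R : realType) m n (A : 'M[R]_(m, n)) (V : nat -> 'rV[R]_n) k :=
  forall i, (i < k)%N -> exists q, [/\ q != 0, greedy_row A (residual V i) q &
    V i = (Num.sqrt (sqnorm q))^-1 *: q].

Definition orthonormal (R : realType) n (V : nat -> 'rV[R]_n) k :=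
  forall i j, (i < k)%N -> (j < k)%N -> V i *m (V j)^T = ((i == j)%:R)%:M.

Section Residual.
Variables (R : realType) (n : nat) (V : nat -> 'rV[R]_n).

Lemma residual0 : residual V 0 = 1%:M.
Proof. by rewrite /residual big_ord0 subr0. Qed.

Lemma residualS k : residual V k.+1 = residual V k - (V k)^T *m V k.
Proof. by rewrite /residual big_ord_recr /= opprD addrA. Qed.

Lemma residual_tr k : (residual V k)^T = residual V k.
Proof.
rewrite linearB /= trmx1 linear_sum /=; congr (_ - _).
by apply: eq_bigr => i _; rewrite trmx_mul trmxK.
Qed.

Lemma mul_residual0 k i : orthonormal V k -> (i < k)%N -> V i *m residual V k = 0.
Proof.
move=> oV ik; rewrite mulmxBr mulmx1 mulmx_sumr (bigD1 (Ordinal ik))//= big1.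
  by rewrite mulmxA oV// eqxx mul1mx addr0 subrr.
move=> j ji; rewrite mulmxA oV//.
rewrite (_ : (i == j) = false) ?scale_scalar_mx ?mul_scalar_mx ?scale0r//.
by apply/negbTE; apply: contra ji => /eqP e; apply/eqP/val_inj.
Qed.

Lemma residual_idem k : orthonormal V k ->
  residual V k *m residual V k = residual V k.
Proof.
move=> oV; rewrite {1}/residual mulmxBl mul1mx mulmx_suml big1 ?subr0// => i _.
by rewrite -mulmxA mul_residual0// mulmx0.
Qed.

(** The trace of the residual projection is n - k, which is not zero. *)
Lemma residual_row_neq0 k : orthonormal V k -> (k < n)%N ->
  exists p, row p (residual V k) != 0.
Proof.
move=> oV kn; apply/existsP; apply: contraT; rewrite negb_exists => /forallP E0.
have /(congr1 mxtrace) : residual V k = 0.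
  by apply/row_matrixP => p; rewrite row0; apply/eqP; have := E0 p; rewrite negbK.
have trS : \tr (\sum_(i < k) (V i)^T *m V i) = k%:R.
  rewrite [LHS]raddf_sum (eq_bigr (fun=> 1)) ?sumr_const ?card_ord// => i _.
  by rewrite /= mxtrace_mulC oV// eqxx mxtrace1.
rewrite /residual [LHS]raddfB [X in X - _]mxtrace1 [X in _ - X]trS mxtrace0.
by move/eqP; rewrite subr_eq0 eqr_nat => /eqP e; rewrite e ltnn in kn.
Qed.

End Residual.

Lemma eq_residual (R : realType) n (V V' : nat -> 'rV[R]_n) k :
  (forall i, (i < k)%N -> V i = V' i) -> residual V k = residual V' k.
Proof. by move=> e; congr (_ - _); apply: eq_bigr => i _; rewrite e. Qed.

Section Greedy.
Variables (R : realType) (m n : nat) (A : 'M[R]_(m, n)) (V : nat -> 'rV[R]_n).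

Lemma greedyS k : greedy A V k.+1 -> greedy A V k.
Proof. by move=> gV i ik; apply: gV; rewrite ltnW. Qed.

Lemma greedy_row_residual k q : orthonormal V k ->
  greedy_row A (residual V k) q -> q *m residual V k = q.
Proof.
move=> oV [[p [-> _]]|[_ [p ->]]]; rewrite -row_mul ?residual_idem//.
by rewrite -mulmxA residual_idem.
Qed.

Lemma sqnorm_normalize (q : 'rV[R]_n) : q != 0 ->
  ((Num.sqrt (sqnorm q))^-1 *: q) *m ((Num.sqrt (sqnorm q))^-1 *: q)^T = 1%:M.
Proof.
rewrite -sqnorm_eq0 => q0.
rewrite [_ *m _]mx11_scalar; congr (_%:M).
rewrite linearZ /= -scalemxAl -scalemxAr !mxE [X in _ * (_ * X)](_ : _ = sqnorm q).
  have e : Num.sqrt (sqnorm q) ^+ 2 = sqnorm q by rewrite sqr_sqrtr// sqnorm_ge0.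
  rewrite -{3}e; field.
  by rewrite sqrtr_eq0 -ltNge lt_def q0 sqnorm_ge0.
by rewrite sqnormE mxE.
Qed.

(** A new vector is fixed by the residual projection, which annihilates all earlier vectors. *)
Lemma greedy_orthonormal k : greedy A V k -> orthonormal V k.
Proof.
elim: k => [|k IHk] gV; first by move=> i j; rewrite ltn0.
have oV := IHk (greedyS gV).
have [q [q0 qE Vk]] := gV k (ltnSn k).
have new j : (j < k)%N -> V k *m (V j)^T = 0.
  move=> jk; rewrite Vk -(greedy_row_residual oV qE) -scalemxAl -mulmxA.
  by rewrite -residual_tr -trmx_mul mul_residual0// trmx0 mulmx0 scaler0.
move=> i j; rewrite !ltnS leq_eqVlt => /predU1P[->|ik].
  rewrite leq_eqVlt => /predU1P[->|jk]; first by rewrite eqxx Vk sqnorm_normalize.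
  by rewrite new// gtn_eqF//; apply/matrixP => ? ?; rewrite !mxE mul0rn.
rewrite leq_eqVlt => /predU1P[->|jk]; last exact: oV.
by rewrite mulmx_tr_comm new// ltn_eqF//; apply/matrixP => ? ?; rewrite !mxE mul0rn.
Qed.

Lemma greedy_mul_residual k : greedy A V k.+1 -> V k *m residual V k = V k.
Proof.
move=> gV; have oV := greedy_orthonormal (greedyS gV).
have [q [_ qE ->]] := gV k (ltnSn k).
by rewrite -scalemxAl (greedy_row_residual oV qE).
Qed.

(** Modified Gram-Schmidt: the coefficient along [V k] can be taken from the current residual
    instead of the original row, as [deflate_prog] does. *)
Lemma mul_greedy_residualS k p (u : 'M[R]_(p, n)) : greedy A V k.+1 ->
  u *m residual V k.+1 =
  u *m residual V k - (u *m residual V k *m (V k)^T) *m V k.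
Proof.
move=> gV; rewrite residualS mulmxBr; congr (_ - _); rewrite mulmxA; congr (_ *m _).
rewrite -{1}(greedy_mul_residual gV) trmx_mul residual_tr; exact: mulmxA.
Qed.

(** Pythagoras: the squared norm drops by the square of the coefficient along the unit vector
    [V k]. *)
Lemma sqnorm_residualS_le k (u : 'rV[R]_n) : greedy A V k.+1 ->
  sqnorm (u *m residual V k.+1) <= sqnorm (u *m residual V k).
Proof.
move=> gV; rewrite (mul_greedy_residualS _ gV).
set w := u *m residual V k; set v := V k.
have vv : v *m v^T = 1%:M.
  by have := greedy_orthonormal gV (ltnSn k) (ltnSn k); rewrite eqxx.
set x := (w *m v^T) 0 0.
have ex : w *m v^T = x%:M by exact: mx11_scalar.
have ex' : v *m w^T = x%:M by rewrite mulmx_tr_comm.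
rewrite ex mul_scalar_mx !sqnormE [(_ - _)^T]linearB /= [(_ *: _)^T]linearZ /=.
rewrite mulmxBl !mulmxBr.
rewrite -!scalemxAl -!scalemxAr ex ex' vv !mxE eqxx mulr1n.
rewrite mulr1 subrr subr0 gerBl; exact: (sqr_ge0 x).
Qed.

(** The rows of [ps] have no residual, hence are orthogonal to [q]; so their Gram matrix fixes [q]
    and [det_rank1_update_ge] applies. *)
Lemma det_gram_cons_ge k (h : R) p ps : 0 < h -> orthonormal V k ->
  (forall p', p' \in ps -> row p' A *m residual V k = 0) ->
  0 < \det (gram A h ps) ->
  \det (gram A h ps) * (1 + h^-2 * sqnorm (row p A *m residual V k)) <=
    \det (gram A h (p :: ps)).
Proof.
move=> h0 oV psE d0; set q := row p A *m residual V k.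
have qEq : q *m residual V k = q by rewrite -mulmxA residual_idem.
rewrite [X in _ <= \det X](_ : _ =
    h^-2 *: ((row p A)^T *m row p A) + gram A h ps); last first.
  by rewrite /gram big_cons addrCA.
apply: det_rank1_update_ge => //; first exact: gram_posdef.
- by rewrite invr_ge0 exprn_ge0// ltW.
- rewrite mulmxDr mulmx1 mulmx_sumr big1_seq ?addr0// => p' /andP[_ ps_p'].
  rewrite -scalemxAr mulmxA mulmx_tr_comm -qEq trmx_mul residual_tr mulmxA.
  by rewrite psE// !mul0mx scaler0.
- rewrite mulmxBl; apply/eqP; rewrite subr_eq0; apply/eqP.
  by rewrite -{1}qEq trmx_mul residual_tr mulmxA.
Qed.

(* Every chosen residual is at least the current maximal one, so each new row
   multiplies the Gram determinant by at least rho / h ^+ 2. *)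
Lemma greedy_gram k (h : R) : 0 < h -> greedy A V k ->
  A *m residual V k = 0 \/
  exists ps : seq 'I_m, [/\ size ps = k,
    forall p, p \in ps -> row p A *m residual V k = 0,
    0 < \det (gram A h ps) &
    forall p, (sqnorm (row p A *m residual V k) / h ^+ 2) ^+ k <=
       \det (gram A h ps)].
Proof.
move=> h0; elim: k => [|k IHk] gV.
  right; exists [::]; split=> //; last move=> p.
    by rewrite /gram big_nil addr0 det1.
  by rewrite /gram big_nil addr0 det1.
have gV' := greedyS gV; have oV := greedy_orthonormal gV'.
have [A0|[ps [szps psE d0 dge]]] := IHk gV'.
  by left; rewrite (mul_greedy_residualS _ gV) A0 !mul0mx subr0.
have [q [q0 qE Vk]] := gV k (ltnSn k).
have qEq := greedy_row_residual oV qE.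
have h20 : 0 < h ^+ 2 by rewrite exprn_gt0.
case: qE => [[p [ep pmax]]|[A0 _]]; last first.
  by left; rewrite (mul_greedy_residualS _ gV) A0 !mul0mx subr0.
right; exists (p :: ps).
have eq : q = row p A *m residual V k by rewrite ep row_mul.
have step := det_gram_cons_ge p h0 oV psE d0.
rewrite -eq in step.
split.
- by rewrite /= szps.
- move=> p'; rewrite in_cons (mul_greedy_residualS _ gV) => /predU1P[->|/psE ->].
    (* The residual of the picked row is a multiple of [V k], so it is removed entirely. *)
    rewrite -eq Vk [(_ *: _)^T]linearZ /= -!scalemxAr -scalemxAl scalerA.
    rewrite [q *m q^T]mx11_scalar -sqnormE mul_scalar_mx scalerA -expr2 exprVn.
    rewrite sqr_sqrtr ?sqnorm_ge0// mulVf ?scale1r ?subrr//.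
    by rewrite sqnorm_eq0.
  by rewrite !mul0mx subr0.
- apply: lt_le_trans step; apply: mulr_gt0 => //.
  by rewrite ltr_pwDl// mulr_ge0 ?sqnorm_ge0// invr_ge0 ltW.
- move=> p'; apply: le_trans step; rewrite exprSr.
  have nn (u : 'rV[R]_n) : 0 <= sqnorm u / h ^+ 2 by rewrite divr_ge0 ?sqnorm_ge0// ltW.
  have le1 := sqnorm_residualS_le (row p' A) gV.
  have le2 : sqnorm (row p' A *m residual V k) <= sqnorm q by rewrite -row_mul.
  have le1h : sqnorm (row p' A *m residual V k.+1) / h ^+ 2 <=
              sqnorm (row p' A *m residual V k) / h ^+ 2.
    by rewrite ler_pM2r ?invr_gt0.
  have le2h : sqnorm (row p' A *m residual V k.+1) / h ^+ 2 <= sqnorm q / h ^+ 2.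
    by rewrite ler_pM2r ?invr_gt0// (le_trans le1).
  (* The first [k] factors are bounded because residuals shrink, the last one because [q] was
     maximal. *)
  apply: ler_pM => //; first exact: exprn_ge0.
    apply: le_trans (dge p'); rewrite lerXn2r ?nnegrE//.
  by apply: (le_trans le2h); rewrite mulrC lerDr.
Qed.

End Greedy.

(** Adding the row [p] itself gives k + 1 factors below the determinant. As n <= 4 (k + 1) and n + k
    + 1 <= 5 (k + 1), [det_gram_le] is at most [C ^+ k.+1], and roots of order k + 1 can be
    compared. *)
Lemma greedy_bound (R : realType) m n (A : 'M[R]_(m, n)) (V : nat -> 'rV[R]_n) k p :
  greedy A V k -> (n <= 4 * k.+1)%N ->
  l2norm (row p A *m residual V k) <= 8 ^+ 4 * expR 5 * herdisc A.
Proof.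
move=> gV nk; set C := 8 ^+ 4 * expR 5.
have C0 : 0 < C by rewrite mulr_gt0 ?expR_gt0// exprn_gt0.
rewrite -[l2norm _]/(Num.sqrt (sqnorm _)).
(* [herdisc A] may be 0, so the bound is shown for every positive [h] above it and passed to the
   limit. *)
suff bound h : 0 < h -> herdisc A <= h ->
    Num.sqrt (sqnorm (row p A *m residual V k)) <= C * h.
  apply/ler_addgt0Pr => e e0.
  rewrite (_ : _ + e = C * (herdisc A + e / C)).
    apply: bound; last by rewrite lerDl ltW// divr_gt0.
    by rewrite ltr_wpDl ?herdisc_ge0// divr_gt0.
  by rewrite mulrDr; congr (_ + _); rewrite mulrCA mulfV ?mulr1// lt0r_neq0.
move=> h0 Ah.
have oV := greedy_orthonormal gV.
have h20 : 0 < h ^+ 2 by rewrite exprn_gt0.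
have [A0|[ps [szps psE d0 dge]]] := greedy_gram h0 gV.
  rewrite -row_mul A0 row0.
  by rewrite (_ : sqnorm _ = 0) ?sqrtr0 ?mulr_ge0 ?ltW//; apply/eqP; rewrite sqnorm_eq0.
set q := row p A *m residual V k.
have qEq : q *m residual V k = q by rewrite -mulmxA residual_idem.
have step := det_gram_cons_ge p h0 oV psE d0; rewrite -/q in step.
have {}step : (Num.sqrt (sqnorm q) / h) ^+ k.+1 <= C ^+ k.+1.
  apply: (@le_trans _ _ (8 ^+ n * expR (n + size (p :: ps))%:R)); last first.
    rewrite /= szps exprMn -exprM -expRM_natl.
    apply: ler_pM; rewrite ?exprn_ge0 ?expR_ge0//.
      by rewrite ler_eXn2l// ltr1n.
    by rewrite ler_expR -natrM ler_nat; lia.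
  apply: le_trans (det_gram_le (p :: ps) h0 Ah).
  rewrite -[leLHS]ger0_norm; last by rewrite exprn_ge0 ?divr_ge0 ?sqrtr_ge0 ?(ltW h0).
  rewrite -[leLHS]sqrtr_sqr ler_wsqrtr// -exprM mulnC exprM.
  rewrite [(_ / h) ^+ 2]expr_div_n sqr_sqrtr ?sqnorm_ge0//; apply: le_trans step.
  rewrite exprSr; apply: ler_pM; rewrite ?exprn_ge0 ?divr_ge0 ?sqnorm_ge0 ?(ltW h20)//.
    exact: dge.
  by rewrite mulrC lerDr.
have : Num.sqrt (sqnorm q) / h <= C.
  by rewrite -(@ler_pXn2r _ k.+1) ?nnegrE ?divr_ge0 ?sqrtr_ge0 ?(ltW h0) ?(ltW C0).
by rewrite ler_pdivrMr.
Qed.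

(** * A weakest precondition calculus for the machine *)

(** Total correctness with a time budget: termination is part of the claim. *)
Definition wp (R : realType) (c : cmd) (s : state R) (T : nat)
    (Q : state R -> Prop) : Prop :=
  exists t s', [/\ exec c s t s', (t <= T)%N & Q s'].

Section Wp.
Variable R : realType.
Implicit Types (s : state R) (Q : state R -> Prop).

Lemma wp_conseq c s T T' Q Q' : wp c s T Q -> (T <= T')%N ->
  (forall s', Q s' -> Q' s') -> wp c s T' Q'.
Proof.
move=> [t [s' [e tT q]]] TT' QQ'; exists t, s'; split=> //; last exact: QQ'.
exact: leq_trans TT'.
Qed.

Lemma wp_skip s Q : Q s -> wp Skip s 1 Q.
Proof. by move=> q; exists 1%N, s; split=> //; constructor. Qed.

Lemma wp_iset s a e v Q : Q (iset s a (ieval s e) (ieval s v)) ->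
  wp (ISet a e v) s (icost e + icost v).+1 Q.
Proof. by move=> q; eexists; eexists; split; [constructor|by []|]. Qed.

Lemma wp_rset s a e v Q : Q (rset s a (ieval s e) (reval s v)) ->
  wp (RSet a e v) s (icost e + rcost v).+1 Q.
Proof. by move=> q; eexists; eexists; split; [constructor|by []|]. Qed.

Lemma wp_seq c1 c2 s T1 T2 Q : wp c1 s T1 (fun s1 => wp c2 s1 T2 Q) ->
  wp (Seq c1 c2) s (T1 + T2) Q.
Proof.
move=> [t1 [s1 [e1 l1 [t2 [s2 [e2 l2 q]]]]]].
exists (t1 + t2)%N, s2; split=> //; first exact: ESeq e2.
exact: leq_add.
Qed.

Lemma wp_if b c1 c2 s T Q : wp (if beval s b then c1 else c2) s T Q ->
  wp (If b c1 c2) s (bcost b + T).+1 Q.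
Proof.
move=> [t [s' [e l q]]]; exists (bcost b + t).+1, s'; split=> //.
  by case: ifPn e => bs e; [apply: EIfTrue|apply: EIfFalse].
by rewrite ltnS leq_add2l.
Qed.

(** The invariant is indexed by the number of passes made, which is known in advance; the last
    summand pays for the failing test. *)
Lemma wp_while (I : nat -> state R -> Prop) N T b c s :
  I 0%N s ->
  (forall k s', (k < N)%N -> I k s' -> beval s' b /\ wp c s' T (I k.+1)) ->
  (forall s', I N s' -> ~~ beval s' b) ->
  wp (While b c) s (N * (bcost b + T).+1 + (bcost b).+1) (I N).
Proof.
move=> I0 IS IN.
suff H d : forall k s', (k + d = N)%N -> I k s' ->
    wp (While b c) s' (d * (bcost b + T).+1 + (bcost b).+1) (I N).
  exact: (H N 0%N).
elim: d => [|d IHd] k s' kd Ik.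
  rewrite addn0 in kd; subst k.
  exists (bcost b).+1, s'; split=> //; exact/EWhileFalse/IN.
have kN : (k < N)%N by lia.
have [bs [t1 [s1 [e1 l1 I1]]]] := IS k s' kN Ik.
have kd1 : (k.+1 + d = N)%N by lia.
have [t2 [s2 [e2 l2 I2]]] := IHd _ _ kd1 I1.
exists (bcost b + t1 + t2).+1, s2; split=> //; first exact: EWhileTrue e2.
rewrite mulSn; lia.
Qed.

End Wp.

Definition var (c : nat) : iexp := IGet 0 (ILit c).
Definition setv (c : nat) (e : iexp) : cmd := ISet 0 (ILit c) e.

Definition for_loop (c : nat) (e : iexp) (body : cmd) : cmd :=
  Seq (setv c (ILit 0))
    (While (BNot (BLeI e (var c))) (Seq body (setv c (IAdd (var c) (ILit 1))))).

(** The body must preserve the counter, and [I] is required after the increment that follows it. The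
    bound [e] is evaluated again at each test, so it must keep the value [N]. *)
Lemma wp_for (R : realType) (I : nat -> state R -> Prop) N T c e body s :
  I 0%N (iset s 0 c 0) ->
  (forall k s', I k s' -> imem s' 0 c = k -> ieval s' e = N) ->
  (forall k s', (k < N)%N -> imem s' 0 c = k -> I k s' ->
     wp body s' T (fun s'' => imem s'' 0 c = k /\ I k.+1 (iset s'' 0 c k.+1))) ->
  wp (for_loop c e body) s (N * (T + icost e + 11) + (icost e + 10)) (I N).
Proof.
move=> I0 Ie IS.
pose J k s' := imem s' 0 c = k /\ I k s'.
have H : wp (for_loop c e body) s
    (3 + (N * ((icost e + 2).+2 + (T + 6)).+1 + (icost e + 2).+3)) (J N).
  apply: wp_seq; apply: wp_iset => /=.
  apply: (wp_while (I := J)).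
  - by split=> //=; rewrite /upd /= !eqxx.
  - move=> k s' kN [sk Ik] /=; split; first by rewrite (Ie k)// sk -ltnNge.
    apply: wp_seq; apply: (wp_conseq (IS k s' kN sk Ik) (leqnn _)) => s1 [sk1 I1].
    apply: (@wp_iset _ _ 0 (ILit c) (IAdd (var c) (ILit 1))).
    by rewrite /= sk1 addn1; split=> //=; rewrite /upd !eqxx.
  - by move=> s' [sN IsN] /=; rewrite (Ie N)// sN leqnn.
apply: (wp_conseq H); last by move=> s' [].
nia.
Qed.

(** * The program *)

Definition same_ints (R : realType) (cs : seq nat) (s s' : state R) : Prop :=
  forall c, c \notin cs -> imem s' 0 c = imem s 0 c.

Definition upd_range (T : Type) (f : nat -> nat -> T) (a b N : nat) (g : nat -> T) :
    nat -> nat -> T :=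
  fun a' l => if (a' == a) && (b <= l < b + N)%N then g (l - b)%N else f a' l.

Lemma upd_range0 T (f : nat -> nat -> T) a b g : upd_range f a b 0 g = f.
Proof.
apply/funext => a'; apply/funext => l; rewrite /upd_range.
by case: ifP => // /andP[_]; lia.
Qed.

Lemma upd_rangeS T (f : nat -> nat -> T) a b k g :
  upd (upd_range f a b k g) a (b + k) (g k) = upd_range f a b k.+1 g.
Proof.
apply/funext => a'; apply/funext => l; rewrite /upd /upd_range.
have [->|//] := eqVneq a' a; rewrite /=.
have [->|lk] := eqVneq l (b + k)%N.
  by rewrite addKn ifT//; lia.
rewrite (_ : (b <= l < b + k)%N = (b <= l < b + k.+1)%N)//; lia.
Qed.

Lemma upd_upd T (f : nat -> nat -> T) a k v v' : upd (upd f a k v) a k v' = upd f a k v'.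
Proof. apply/funext => a'; apply/funext => l; rewrite /upd; by case: ifP => // ->. Qed.

(* Integer variables: 0 and 1 the dimensions m and n, 2 the number i of rows
   found, 3 the offset i * n, 4 a row index, 5 its offset, 6 a column index, 7
   the offset of the selected row.  Real array 0: the m residual rows of A,
   then the n residual rows of the identity; array 1: the rows found; cells 0
   and 1 of array 2: a dot product and the largest squared norm. *)
Definition dot_prog (a x b y : nat) : cmd :=
  Seq (RSet 2 (ILit 0) (RLit 0))
    (for_loop 6 (var 1) (RSet 2 (ILit 0) (RAdd (RGet 2 (ILit 0))
      (RMul (RGet a (IAdd (var x) (var 6))) (RGet b (IAdd (var y) (var 6))))))).

Definition row_prog (a x : nat) (e : rexp) : cmd :=
  for_loop 6 (var 1) (RSet a (IAdd (var x) (var 6)) e).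

(** A row of the identity, of index at least m, is accepted only while the best value is 0, that is,
    after all residuals of A were found to vanish. *)
Definition scan_prog : cmd :=
  Seq (setv 5 (ILit 0)) (Seq (RSet 2 (ILit 1) (RLit 0)) (Seq (setv 7 (ILit 0))
  (for_loop 4 (IAdd (var 0) (var 1))
    (Seq (dot_prog 0 5 0 5)
    (Seq (If (BAnd (BNot (BLeR (RGet 2 (ILit 0)) (RGet 2 (ILit 1))))
                   (BNot (BAnd (BLeI (var 0) (var 4))
                               (BNot (BLeR (RGet 2 (ILit 1)) (RLit 0))))))
             (Seq (RSet 2 (ILit 1) (RGet 2 (ILit 0))) (setv 7 (var 5)))
             Skip)
         (setv 5 (IAdd (var 5) (var 1)))))))).

Definition deflate_prog : cmd :=
  Seq (setv 5 (ILit 0))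
  (for_loop 4 (IAdd (var 0) (var 1))
    (Seq (dot_prog 0 5 1 3)
    (Seq (row_prog 0 5 (RSub (RGet 0 (IAdd (var 5) (var 6)))
            (RMul (RGet 2 (ILit 0)) (RGet 1 (IAdd (var 3) (var 6))))))
         (setv 5 (IAdd (var 5) (var 1)))))).

(** Integers cannot be multiplied, so the first loop computes the offset m * n of the identity block
    by repeated addition. *)
Definition init_prog : cmd :=
  Seq (setv 5 (ILit 0))
  (Seq (for_loop 4 (var 0) (setv 5 (IAdd (var 5) (var 1))))
  (for_loop 4 (var 1)
    (Seq (row_prog 0 5 (RLit 0))
    (Seq (RSet 0 (IAdd (var 5) (var 4)) (RLit 1))
         (setv 5 (IAdd (var 5) (var 1))))))).

Definition step_prog : cmd :=
  Seq scan_prog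
  (Seq (row_prog 1 3 (RDiv (RGet 0 (IAdd (var 7) (var 6))) (RSqrt (RGet 2 (ILit 1)))))
  (Seq deflate_prog
  (Seq (setv 3 (IAdd (var 3) (var 1))) (setv 2 (IAdd (var 2) (ILit 1)))))).

(** The guard 4 i + 4 <= n expresses i < n / 4 without division. *)
Definition greedy_prog : cmd :=
  Seq init_prog (Seq (setv 2 (ILit 0)) (Seq (setv 3 (ILit 0))
  (While (BLeI (IAdd (IAdd (IAdd (var 2) (var 2)) (IAdd (var 2) (var 2))) (ILit 4))
               (var 1))
    step_prog))).

(** * Correctness and cost of the subroutines *)

Section Programs.
Variable R : realType.
Implicit Types s : state R.

Lemma same_ints_refl cs s : same_ints cs s s.
Proof. by []. Qed.

Lemma same_ints_iset cs s s' c v : c \in cs -> same_ints cs s s' ->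
  same_ints cs s (iset s' 0 c v).
Proof.
move=> ccs ss c' c'cs; rewrite /= /upd /= ifF ?ss//.
by apply/eqP => e; rewrite e ccs in c'cs.
Qed.

Lemma same_ints_trans cs s1 s2 s3 : same_ints cs s1 s2 -> same_ints cs s2 s3 ->
  same_ints cs s1 s3.
Proof. by move=> s12 s23 c ccs; rewrite s23// s12. Qed.

Lemma same_ints_sub cs cs' s s' : {subset cs <= cs'} -> same_ints cs s s' ->
  same_ints cs' s s'.
Proof. by move=> sub ss c ccs; apply: ss; apply: contra ccs; exact: sub. Qed.

Lemma wp_dot (a x b y : nat) s : (a != 2)%N -> (b != 2)%N -> (x != 6)%N -> (y != 6)%N ->
  wp (dot_prog a x b y) s (50 * (imem s 0 1).+1) (fun s' => same_ints [:: 6] s s' /\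
    rmem s' = upd (rmem s) 2 0 (\sum_(0 <= j < imem s 0 1)
       rmem s a (imem s 0 x + j) * rmem s b (imem s 0 y + j))).
Proof.
move=> a2 b2 x6 y6; set n := imem s 0 1.
pose I k s' := same_ints [:: 6] s s' /\
  rmem s' = upd (rmem s) 2 0 (\sum_(0 <= j < k)
       rmem s a (imem s 0 x + j) * rmem s b (imem s 0 y + j)).
have H : wp (dot_prog a x b y) s (3 + (n * (18 + 2 + 11) + (2 + 10))) (I n).
  apply: wp_seq; apply: wp_rset; apply: wp_for => /=.
  - split; first exact/same_ints_iset/same_ints_refl.
    by rewrite big_nil.
  - by move=> k s' [ss _] _; rewrite /= ss.
  - move=> k s' kn sk [ss rs]; apply: wp_rset => /=; split=> //; split.
      exact: same_ints_iset.
    rewrite /= sk !ss ?inE// rs upd_upd /upd /= (negPf a2) (negPf b2) /=.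
    by rewrite big_nat_recr.
by apply: (wp_conseq H) => //; lia.
Qed.

(** [e] may read the row being overwritten, so its value is required in the state where exactly the
    first [k] cells have been replaced. *)
Lemma wp_row (a x : nat) e s (f : nat -> R) : (x != 6)%N -> (rcost e <= 20)%N ->
  (forall k s', (k < imem s 0 1)%N -> same_ints [:: 6] s s' -> imem s' 0 6 = k ->
     rmem s' = upd_range (rmem s) a (imem s 0 x) k f -> reval s' e = f k) ->
  wp (row_prog a x e) s (50 * (imem s 0 1).+1) (fun s' => same_ints [:: 6] s s' /\
    rmem s' = upd_range (rmem s) a (imem s 0 x) (imem s 0 1) f).
Proof.
move=> x6 ce He; set n := imem s 0 1.
pose I k s' := same_ints [:: 6] s s' /\
  rmem s' = upd_range (rmem s) a (imem s 0 x) k f.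
have H : wp (row_prog a x e) s (n * ((6 + rcost e) + 2 + 11) + (2 + 10)) (I n).
  apply: wp_for => /=.
  - by split; [exact/same_ints_iset/same_ints_refl|rewrite upd_range0].
  - by move=> k s' [ss _] _; rewrite /= ss.
  - move=> k s' kn sk [ss rs].
    apply: (@wp_rset _ _ a (IAdd (var x) (var 6)) e); split=> //; split.
      exact: same_ints_iset.
    by rewrite /= (He k)// sk ss ?inE// rs upd_rangeS.
by apply: (wp_conseq H) => //; nia.
Qed.

Definition scan_spec (m n : nat) (f : nat -> R) (k p : nat) (best : R) : Prop :=
  [/\ 0 <= best,
      forall r, (r < k)%N -> (r < m)%N -> f r <= best,
      best = 0 -> forall r, (r < k)%N -> f r <= 0 &
      0 < best -> exists2 r, (r < k)%N /\ p = (r * n)%N &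
        best = f r /\ ((r < m)%N \/ forall r', (r' < m)%N -> f r' <= 0)].

Lemma scan_spec_skip m n f k p best : scan_spec m n f k p best ->
  f k <= best \/ (m <= k)%N /\ 0 < best -> scan_spec m n f k.+1 p best.
Proof.
move=> [b0 fb fz fp] fk; split=> //.
- move=> r; rewrite ltnS leq_eqVlt => /predU1P[->|rk] rm; last exact: fb.
  by case: fk => // -[mk _]; rewrite ltnNge mk in rm.
- move=> bz r; rewrite ltnS leq_eqVlt => /predU1P[->|rk]; last exact: fz.
  by rewrite bz in fk *; case: fk => // -[_]; rewrite ltxx.
- by move=> /fp[r [rk pr] br]; exists r => //; split=> //; exact: ltnW.
Qed.

Lemma scan_spec_take m n f k p best : scan_spec m n f k p best ->
  best < f k -> (k < m)%N \/ best <= 0 -> scan_spec m n f k.+1 (k * n) (f k).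
Proof.
move=> [b0 fb fz fp] fk km; split.
- exact: ltW (le_lt_trans b0 fk).
- move=> r; rewrite ltnS leq_eqVlt => /predU1P[->|rk] rm //.
  by apply: le_trans (ltW fk); exact: fb.
- by move=> f0; move: fk; rewrite f0 ltNge b0.
- move=> _; exists k => //; split=> //.
  (* A row of the identity is taken only at [best] 0, and then all rows of A, scanned before it, are
     null. *)
  case: km => [|bz]; [by left|].
  have [km|mk] := ltnP k m; [by left|right] => r' r'm.
  by apply: fz; [apply/eqP; rewrite eq_le bz b0|exact: leq_trans mk].
Qed.

Lemma wp_scan s : let m := imem s 0 0 in let n := imem s 0 1 in
  let f r := \sum_(0 <= j < n) rmem s 0 (r * n + j) * rmem s 0 (r * n + j) in
  wp scan_prog s (200 * (n.+1 * (m + n).+1)) (fun s' =>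
    [/\ same_ints [:: 4; 5; 6; 7] s s', forall a l : nat, (a != 2)%N -> rmem s' a l = rmem s a l &
      scan_spec m n f (m + n) (imem s' 0 7) (rmem s' 2 1)]).
Proof.
move=> m n f.
pose I k s' := [/\ same_ints [:: 4; 5; 6; 7] s s', imem s' 0 5 = (k * n)%N,
   forall a l : nat, (a != 2)%N -> rmem s' a l = rmem s a l &
   scan_spec m n f k (imem s' 0 7) (rmem s' 2 1)].
have H : wp scan_prog s (3 + (3 + (3 +
    ((m + n) * ((50 * n.+1 + (28 + 7)) + 5 + 11) + (5 + 10))))) (I (m + n)%N).
  apply: wp_seq; apply: wp_iset; apply: wp_seq; apply: wp_rset.
  apply: wp_seq; apply: wp_iset; apply: wp_for => /=.
  - split=> /=.
    + by do 3 (apply: same_ints_iset => //).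
    + by rewrite /upd.
    + by move=> a l a2; rewrite /upd (negPf a2).
    + by split; rewrite /upd /= ?mulr0n// ltxx.
  - by move=> k s' [ss _ _ _] _; rewrite /= !ss.
  - move=> k s' kmn sk [ss s5 rs sp].
    have s1n : imem s' 0 1 = n by rewrite ss.
    apply: wp_seq; have D := @wp_dot 0%N 5%N 0%N 5%N s' isT isT isT isT.
    rewrite s1n in D; apply: (wp_conseq D (leqnn _)) => s1 [ss1 rs1].
    have acc : rmem s1 2 0 = f k.
      by rewrite rs1 /upd /= s5; apply: eq_bigr => j _; rewrite !rs.
    have rs1' (a l : nat) : (a != 2)%N -> rmem s1 a l = rmem s a l.
      by move=> a2; rewrite rs1 /upd (negPf a2) rs.
    have best1 : rmem s1 2 1 = rmem s' 2 1 by rewrite rs1 /upd.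
    have ss1' : same_ints [:: 4; 5; 6; 7] s s1.
      apply: (same_ints_trans ss); apply: (same_ints_sub _ ss1) => c.
      by rewrite inE => /eqP ->.
    apply: wp_seq.
    have sel : wp (If (BAnd (BNot (BLeR (RGet 2 (ILit 0)) (RGet 2 (ILit 1))))
                   (BNot (BAnd (BLeI (var 0) (var 4))
                               (BNot (BLeR (RGet 2 (ILit 1)) (RLit 0))))))
             (Seq (RSet 2 (ILit 1) (RGet 2 (ILit 0))) (setv 7 (var 5)))
             Skip) s1 28 (fun s2 => [/\ same_ints [:: 7] s1 s2,
          forall a l : nat, (a != 2)%N -> rmem s2 a l = rmem s a l &
          scan_spec m n f k.+1 (imem s2 0 7) (rmem s2 2 1)]).
      apply: (@wp_if _ _ _ _ _ 8) => /=; rewrite acc best1.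
      rewrite ss1' // ss1 // sk mulr0n.
      case: ifP => cond.
        apply: (@wp_seq _ _ _ _ 4 4); apply: wp_rset; apply: wp_iset; split.
        + exact: same_ints_iset.
        + by move=> a l a2; rewrite /= /upd (negPf a2) /=; exact: rs1'.
        + rewrite /= /upd /= ss1// s5 acc.
          case/andP: cond; rewrite -ltNge negb_and negbK -ltnNge => c1 /orP c2.
          exact: scan_spec_take sp c1 c2.
      apply: (@wp_conseq _ Skip s1 1 8 (eq s1)); [exact: wp_skip|by []|].
      move=> s2 <-; split=> //.
      rewrite best1 ss1//; apply: scan_spec_skip => //.
      move/negbT: cond; rewrite negb_and !negbK => /orP[|/andP[]]; first by left.
      by rewrite -ltNge; right.
    apply: (wp_conseq sel (leqnn _)) => s2 [ss2 rs2 sp2].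
    apply: wp_iset => /=; split; first by rewrite /upd /= ss2// ss1.
    split=> //=.
    + do 2 (apply: same_ints_iset => //); apply: (same_ints_trans ss1').
      by apply: (same_ints_sub _ ss2) => c; rewrite inE => /eqP ->.
    + rewrite /upd /= !ss2// ss1// s5 ss1'// mulSn addnC; congr addn.
apply: (wp_conseq H); first by nia.
by move=> s' [].
Qed.

Lemma wp_deflate s : let m := imem s 0 0 in let n := imem s 0 1 in
  let w r j := rmem s 0 (r * n + j) in
  let v j := rmem s 1 (imem s 0 3 + j) in
  wp deflate_prog s (200 * (n.+1 * (m + n).+1)) (fun s' =>
    [/\ same_ints [:: 4; 5; 6] s s', forall l, rmem s' 1 l = rmem s 1 l &
      forall r j, (r < m + n)%N -> (j < n)%N -> rmem s' 0 (r * n + j) =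
        w r j - (\sum_(0 <= j' < n) w r j' * v j') * v j]).
Proof.
move=> m n w v.
(* The rows from [k] on are still the original ones, so the coefficient of row [k] comes from
   unmodified entries. *)
pose I k s' := [/\ same_ints [:: 4; 5; 6] s s', imem s' 0 5 = (k * n)%N,
   forall l, rmem s' 1 l = rmem s 1 l,
   forall l, (k * n <= l)%N -> rmem s' 0 l = rmem s 0 l &
   forall r j, (r < k)%N -> (j < n)%N -> rmem s' 0 (r * n + j) =
        w r j - (\sum_(0 <= j' < n) w r j' * v j') * v j].
have H : wp deflate_prog s (3 +
    ((m + n) * ((50 * n.+1 + (50 * n.+1 + 7)) + 5 + 11) + (5 + 10))) (I (m + n)%N).
  apply: wp_seq; apply: wp_iset; apply: wp_for => /=.
  - by split=> //=; do 2 (apply: same_ints_iset => //).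
  - by move=> k s' [ss _ _ _ _] _; rewrite /= !ss.
  - move=> k s' kmn sk [ss s5 rs1 rs0 rsk].
    have s1n : imem s' 0 1 = n by rewrite ss.
    apply: wp_seq; have D := @wp_dot 0%N 5%N 1%N 3%N s' isT isT isT isT.
    rewrite s1n in D; apply: (wp_conseq D (leqnn _)) => s1 [ss1 rs1'].
    set acc := \sum_(0 <= j' < n) w k j' * v j'.
    have eacc : rmem s1 2 0 = acc.
      rewrite rs1' /upd /= s5; apply: eq_bigr => j _; rewrite rs1 ss//.
      by rewrite rs0// leq_addr.
    have s1n' : imem s1 0 1 = n by rewrite ss1.
    apply: wp_seq.
    have E := @wp_row 0%N 5%N (RSub (RGet 0 (IAdd (var 5) (var 6)))
            (RMul (RGet 2 (ILit 0)) (RGet 1 (IAdd (var 3) (var 6))))) s1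
            (fun j => w k j - acc * v j) isT isT.
    rewrite s1n' in E.
    have {}E := E _.
    apply: (wp_conseq (E _) (leqnn _)) => [j s2 jn ss2 s2j rs2 /=|s2 [ss2 rs2]].
      rewrite s2j !ss2// !ss1// s5 ss//; congr (_ - _ * _).
      + rewrite rs2 /upd_range /= ss1// s5 ltnn andbF rs1' /upd /=.
        by rewrite rs0// leq_addr.
      + by rewrite rs2 /upd_range /= eacc.
      + by rewrite rs2 /upd_range /= rs1' /upd /= rs1.
    apply: wp_iset; split; first by rewrite /= /upd /= ss2// ss1.
    have rs2' a l : rmem s2 a l = if (a == 0%N) && (k * n <= l < k * n + n)%N
        then w k (l - k * n)%N - acc * v (l - k * n)%N else rmem s1 a l.
      by rewrite rs2 /upd_range ss1// s5.
    have rs10 l : rmem s1 0 l = rmem s' 0 l by rewrite rs1' /upd.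
    split=> /=.
    + do 2 (apply: same_ints_iset => //).
      apply: (same_ints_trans ss); apply: (@same_ints_sub [:: 6]).
        by move=> c; rewrite inE => /eqP ->.
      exact: same_ints_trans ss2.
    + by rewrite /upd /= !ss2// !ss1// s5 ss// mulSn addnC.
    + by move=> l; rewrite rs2' /= rs1' /upd /= rs1.
    + move=> l kl; rewrite rs2' /= ifF ?rs10 ?rs0//; rewrite mulSn in kl; lia.
    + move=> r j; rewrite ltnS leq_eqVlt => /predU1P[->|rk] jn.
        by rewrite rs2' /= leq_addr ltn_add2l jn addKn.
      rewrite rs2' /= ifF ?rs10 ?rsk//.
      have : (r.+1 * n <= k * n)%N by rewrite leq_mul2r rk orbT.
      rewrite mulSn; lia.
apply: (wp_conseq H); first by nia.
by move=> s' [].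
Qed.

End Programs.

(** * Loop invariant and running time of the whole program *)

Section GreedyProgram.
Variables (R : realType) (m n : nat) (A : 'M[R]_(m, n)).
Implicit Types s : state R.

(** The loop invariant. The lower block of real array 0 is the residual projection itself, which
    supplies the fallback rows. *)
Definition greedy_state k s : Prop :=
  [/\ imem s 0 0 = m, imem s 0 1 = n, imem s 0 2 = k, imem s 0 3 = (k * n)%N &
    exists V, [/\ greedy A V k,
      forall i (j : 'I_n), (i < k)%N -> rmem s 1 (i * n + j) = V i 0 j &
      stores s 0 (col_mx A 1%:M *m residual V k)]].

Lemma wp_init s : input A s ->
  wp init_prog s (200 * (n.+1 * (m + n).+1)) (fun s' =>
    [/\ imem s' 0 0 = m, imem s' 0 1 = n & stores s' 0 (col_mx A 1%:M)]).
Proof.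
move=> [s0 s1 sA].
pose J k s' := [/\ same_ints [:: 4; 5; 6] s s', imem s' 0 5 = (k * n)%N &
  rmem s' = rmem s].
pose I k s' := [/\ same_ints [:: 4; 5; 6] s s', imem s' 0 5 = ((m + k) * n)%N,
   forall l, (l < m * n)%N -> rmem s' 0 l = rmem s 0 l &
   forall r j, (r < k)%N -> (j < n)%N -> rmem s' 0 ((m + r) * n + j) = (r == j)%:R].
have H : wp init_prog s (3 + ((m * (7 + 2 + 11) + (2 + 10)) +
    (n * ((50 * n.+1 + (7 + 7)) + 2 + 11) + (2 + 10)))) (I n).
  apply: wp_seq; apply: wp_iset; apply: wp_seq.
  apply: (wp_conseq (T := m * (7 + 2 + 11) + (2 + 10)) (Q := J m)) => //.
    apply: wp_for => /=.
    - by split=> //; do 2 (apply: same_ints_iset => //).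
    - by move=> k s' [ss _ _] _; rewrite /= ss.
    - move=> k s' km sk [ss s5 rs]; apply: wp_iset; split=> //; split=> //=.
        by do 2 (apply: same_ints_iset => //).
      by rewrite /upd /= s5 ss// s1 mulSn addnC.
  move=> {}s' [ss' s5' rs']; apply: wp_for => /=.
  - by split=> //=; [apply: same_ints_iset|rewrite addn0|rewrite rs'].
  - by move=> k s2 [ss _ _ _] _; rewrite /= ss.
  - move=> k s2 kn sk [ss s5 rl rr].
    have s21 : imem s2 0 1 = n by rewrite ss.
    have E := @wp_row R 0%N 5%N (RLit 0) s2 (fun=> 0) isT isT.
    rewrite s21 in E; apply: wp_seq.
    apply: (wp_conseq (E _) (leqnn _)) => // s3 [ss3 rs3].
    apply: wp_seq; apply: wp_rset; apply: wp_iset; split.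
      by rewrite /= /upd /= ss3.
    have rs4 l : rmem (iset (iset (rset s3 0 (ieval s3 (IAdd (var 5) (var 4)))
        (reval s3 (RLit 1))) 0 (ieval (rset s3 0 (ieval s3 (IAdd (var 5) (var 4)))
        (reval s3 (RLit 1))) (ILit 5)) (ieval (rset s3 0 (ieval s3 (IAdd (var 5) (var 4)))
        (reval s3 (RLit 1))) (IAdd (var 5) (var 1)))) 0 4 k.+1) 0 l =
       if l == ((m + k) * n + k)%N then 1 else
       if ((m + k) * n <= l < (m + k) * n + n)%N then 0 else rmem s2 0 l.
      by rewrite /= /upd /= !ss3// rs3 /upd_range !s5 sk /=.
    split.
    + do 2 (apply: same_ints_iset => //).
      apply: (same_ints_trans ss); apply: (@same_ints_sub _ [:: 6]) => //.
      by move=> c; rewrite inE => /eqP ->.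
    + by rewrite /= /upd /= !ss3// s5 s21 addnS mulSn addnC.
    + move=> l lm; rewrite rs4 mulnDl ifF ?ifF ?rl//; lia.
    + move=> r j rk jn; rewrite rs4.
      have [->|nrk] := eqVneq r k.
        rewrite eqn_add2l leq_addr ltn_add2l jn /= [k == j]eq_sym.
        by case: ifP.
      have rk' : (r < k)%N by rewrite ltn_neqAle nrk -ltnS.
      have : (r.+1 * n <= k * n)%N by rewrite leq_mul2r rk' orbT.
      rewrite mulSn => rkn.
      rewrite !ifF ?rr// !mulnDl; lia.
apply: (wp_conseq H); first by nia.
move=> s' [ss s5 rl rr]; split; rewrite ?ss// => r j.
rewrite mxE; case: splitP => r' er.
  rewrite er rl ?sA//; have := ltn_ord r'; have := ltn_ord j; nia.
by rewrite er rr// mxE.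
Qed.

Lemma wp_step k s : (k < n)%N -> greedy_state k s ->
  wp step_prog s (500 * (n.+1 * (m + n).+1)) (greedy_state k.+1).
Proof.
move=> kn [s0 s1 s2 s3 [V [gV V1 W0]]].
have oV := greedy_orthonormal gV.
set E := residual V k in W0; set W := col_mx A 1%:M *m E in W0.
set X := (n.+1 * (m + n).+1)%N.
suff H : wp step_prog s (200 * X + (50 * n.+1 + (200 * X + (7 + 6)))) (greedy_state k.+1).
  by apply: (wp_conseq H) => //; rewrite /X; nia.
have S := wp_scan s; rewrite s0 s1 -/X in S.
apply: wp_seq; apply: (wp_conseq S (leqnn _)) => {S} sa [ssa rsa [b0 fb fz fp]].
have fE (r : 'I_(m + n)) : \sum_(0 <= j < n) rmem s 0 (r * n + j) * rmem s 0 (r * n + j)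
    = sqnorm (row r W).
  by rewrite big_mkord; apply: eq_bigr => j _; rewrite W0 [in RHS]mxE expr2.
have Wu p : row (lshift n p) W = row p (A *m E) by rewrite /W mul_col_mx rowKu.
have Wd p : row (rshift m p) W = row p E by rewrite /W mul_col_mx rowKd mul1mx.
(* As k < n, some residual row of the identity is nonzero, so the scan cannot end with best value
   0. *)
have bpos : 0 < rmem sa 2 1.
  rewrite lt_def b0 andbT; apply/eqP => bz.
  have [p] := residual_row_neq0 oV kn.
  have := fz bz (rshift m p) (ltn_ord _); rewrite fE Wd => le0.
  by rewrite -sqnorm_eq0 eq_le sqnorm_ge0 le0.
have [r0 [rmn epr] [eb rm]] := fp bpos.
pose r := Ordinal rmn; set q := row r W.
have {}eb : rmem sa 2 1 = sqnorm q by rewrite eb (fE r).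
have q0 : q != 0 by rewrite -sqnorm_eq0 -eb gt_eqF.
have gq : greedy_row A E q.
  have er : r0 = nat_of_ord r by [].
  rewrite /q; rewrite er in rm; case: (splitP r) => p ep.
    left; exists p; rewrite -Wu (_ : r = lshift n p); last exact/val_inj.
    split=> // p'; rewrite -!Wu -(_ : r = lshift n p); last exact/val_inj.
    rewrite -/q -eb -fE; apply: fb => //=; exact: ltn_addr.
  right; split; last first.
    by exists p; rewrite -Wd (_ : r = rshift m p)//; exact/val_inj.
  case: rm => [|f0]; first by rewrite ep ltnNge leq_addr.
  apply/row_matrixP => p'; rewrite row0 -Wu; apply/eqP.
  by rewrite -sqnorm_eq0 eq_le sqnorm_ge0 -fE f0 /=.
set v := (Num.sqrt (sqnorm q))^-1 *: q.
(* Changing the sequence at index [k] alone leaves all residuals up to [k] as they were. *)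
pose V' i := if i == k then v else V i.
have V'V i : (i < k)%N -> V' i = V i by move=> ik; rewrite /V' ltn_eqF.
have EV' : residual V' k = E by apply: eq_residual.
have gV' : greedy A V' k.+1.
  move=> i; rewrite ltnS leq_eqVlt => /predU1P[->|ik].
    by exists q; rewrite EV' /V' eqxx; split.
  have [q' [q'0 q'E q'V]] := gV i ik; exists q'; rewrite V'V//; split=> //.
  by rewrite (@eq_residual _ _ _ V)// => i' i'i; rewrite V'V// (ltn_trans i'i).
have sa3 : imem sa 0 3 = (k * n)%N by rewrite ssa.
have sa1 : imem sa 0 1 = n by rewrite ssa.
pose g j := rmem sa 0 (r0 * n + j) / Num.sqrt (sqnorm q).
have D := @wp_row R 1%N 3%N (RDiv (RGet 0 (IAdd (var 7) (var 6)))
   (RSqrt (RGet 2 (ILit 1)))) sa g isT isT.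
rewrite sa1 sa3 in D; apply: wp_seq.
apply: (wp_conseq (D _) (leqnn _)) => {D} [j s' jn ss' s'6 rs' /=|sb [ssb rsb]].
  by rewrite ss'// s'6 rs' /upd_range /= epr eb.
have F := wp_deflate sb.
rewrite !ssb// !ssa// s0 s1 s3 -/X in F.
apply: wp_seq; apply: (wp_conseq F (leqnn _)) => {F} sc [ssc rsc1 rsc0].
have rsb0 l : rmem sb 0 l = rmem s 0 l by rewrite rsb /upd_range /= rsa.
have rsbk (j : 'I_n) : rmem sb 1 (k * n + j) = V' k 0 j.
  rewrite rsb /upd_range /= leq_addr ltn_add2l ltn_ord addKn /g rsa//.
  by rewrite (W0 r) /V' eqxx !mxE mulrC.
apply: wp_seq; apply: wp_iset; apply: wp_iset.
split=> /=; rewrite /upd /= ?ssc// ?ssb// ?ssa// ?s2 ?addn1//.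
  by rewrite s3 s1 mulSn addnC.
exists V'; split=> //.
  move=> i j; rewrite ltnS leq_eqVlt /= rsc1 => /predU1P[->|ik]; first exact: rsbk.
  rewrite rsb /upd_range ifF ?rsa//; first by rewrite V1// V'V.
  have : (i.+1 * n <= k * n)%N by rewrite leq_mul2r ik orbT.
  by rewrite mulSn; have := ltn_ord j; lia.
move=> i j /=; rewrite rsc0//.
(* The deflated entries are those of this update formula. *)
rewrite (mul_greedy_residualS _ gV') EV' -/W; move: W0 (V' k) rsbk => {}W0 v' rsbk.
clearbody W; rewrite !mxE big_ord1 rsb0 W0 rsbk big_mkord !mxE.
congr (_ - _ * _); apply: eq_bigr => l _.
by rewrite rsb0 W0 rsbk !mxE.
Qed.

Lemma wp_greedy s : input A s ->
  wp greedy_prog s (1000 * (n.+1 * (m + n).+1 * (n %/ 4).+1))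
    (greedy_state (n %/ 4)).
Proof.
move=> inp; set X := (n.+1 * (m + n).+1)%N; set K := (n %/ 4)%N.
have H : wp greedy_prog s (200 * X + (3 + (3 + (K * (16 + 500 * X).+1 + 17))))
    (greedy_state K).
  apply: wp_seq; apply: (wp_conseq (wp_init inp) (leqnn _)) => s1 [s10 s11 sA].
  apply: wp_seq; apply: wp_iset; apply: wp_seq; apply: wp_iset.
  apply: wp_while => /=.
  - split=> //=; exists (fun=> 0); split=> //.
    by rewrite residual0 mulmx1.
  - move=> k s2 kK gs; have kn : (k < n)%N by rewrite /K in kK; lia.
    split; last exact: wp_step.
    by case: gs => _ /= -> -> _ _; rewrite /K in kK; lia.
  - by move=> s2 [_ /= -> -> _ _]; rewrite /K; lia.
by apply: (wp_conseq H) => //; rewrite /X; nia.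
Qed.

End GreedyProgram.

(** * From the greedy rows to the theorem *)

Lemma lg_ge1 (R : realType) (x : R) : 2 <= x -> 1 <= lg x.
Proof.
move=> x2; have ln20 : 0 < ln (2 : R) by rewrite ln_gt0// ltr1n.
by rewrite /lg ler_pdivlMr// mul1r ler_ln ?posrE//; lra.
Qed.

Lemma greedy_matrix (R : realType) (m n : nat) (A : 'M[R]_(m, n))
    (V : nat -> 'rV[R]_n) (k : nat) :
  greedy A V k -> (n <= 4 * k.+1)%N ->
  let M : 'M[R]_(k, n) := \matrix_(i, j) V i 0 j in
  orthogonal_unit_rows M /\ rows_bounded A M (8 ^+ 4 * expR 5 * herdisc A).
Proof.
move=> gV nk M; have oV := greedy_orthonormal gV.
have rowM i : row i M = V i by apply/rowP => j; rewrite !mxE.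
have dot (i j : 'I_k) : \sum_l M i l * M j l = (i == j)%:R.
  have /matrixP/(_ 0 0) := oV _ _ (ltn_ord i) (ltn_ord j).
  rewrite !mxE eqxx mulr1n => <-; apply: eq_bigr => l _; by rewrite !mxE.
split; first split.
- move=> i; rewrite /l2norm -[RHS]sqrtr1; congr Num.sqrt.
  transitivity (\sum_l M i l * M i l); last by rewrite dot eqxx.
  by apply: eq_bigr => l _; rewrite !mxE expr2.
- by move=> i j ij; rewrite dot (negPf ij).
- move=> p; rewrite row_mul.
  rewrite (_ : 1%:M - _ = residual V k); first exact: greedy_bound.
  congr (_ - _); apply/matrixP => a b; rewrite mxE summxE.
  by apply: eq_bigr => i _; rewrite !mxE big_ord1 !mxE.
Qed.

Theorem theorem3 (R : realType) :
  exists (C K : R) (P : cmd),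
  forall (m n : nat) (A : 'M[R]_(m, n)), (0 < n)%N -> (n <= m)%N ->
    (exists V : 'M[R]_(n %/ 4, n),
       orthogonal_unit_rows V /\
       rows_bounded A V (C * (herdisc A * lg (2 * m%:R / n%:R)))) /\
    (forall s : state R, input A s ->
       exists (V : 'M[R]_(n %/ 4, n)) (t : nat) (s' : state R),
         [/\ orthogonal_unit_rows V,
             rows_bounded A V (C * (herdisc A * lg (2 * m%:R / n%:R))),
             exec P s t s',
             output V s' &
             t%:R <= K * (m%:R * n%:R ^+ 2 * lg (2 + m%:R / n%:R))]).
Proof.
exists (8 ^+ 4 * expR 5), 12000, greedy_prog => m n A n0 nm.
set C := 8 ^+ 4 * expR 5.
have n0R : 0 < n%:R :> R by rewrite ltr0n.
have nmR : n%:R <= m%:R :> R by rewrite ler_nat.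
(* For n <= m both logarithms are at least 1, so bounds without them suffice. *)
have lg1 : 1 <= lg (2 * m%:R / n%:R : R).
  by apply: lg_ge1; rewrite ler_pdivlMr// ler_pM2l.
have lg2 : 1 <= lg (2 + m%:R / n%:R : R).
  by apply: lg_ge1; rewrite lerDl divr_ge0.
have program s : input A s ->
  exists (V : 'M[R]_(n %/ 4, n)) (t : nat) (s' : state R),
    [/\ orthogonal_unit_rows V,
        rows_bounded A V (C * (herdisc A * lg (2 * m%:R / n%:R))),
        exec greedy_prog s t s', output V s' &
        t%:R <= 12000 * (m%:R * n%:R ^+ 2 * lg (2 + m%:R / n%:R)) :> R].
  move=> /wp_greedy[t [s' [e tT [_ _ _ _ [V [gV V1 _]]]]]].
  have nk : (n <= 4 * (n %/ 4).+1)%N by lia.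
  have [oV bV] := greedy_matrix gV nk.
  exists (\matrix_(i, j) V i 0 j), t, s'; split=> //.
  - move=> i; apply: (le_trans (bV i)); rewrite mulrA ler_peMr//.
    by rewrite mulr_ge0 ?herdisc_ge0// mulr_ge0 ?exprn_ge0// expR_ge0.
  - by move=> i j; rewrite V1// mxE.
  (* The three factors give 2 * 3 * 2 = 12, and 1000 * 12 is the time constant. *)
  - have h1 : (n.+1 <= 2 * n)%N by lia.
    have h2 : ((m + n).+1 <= 3 * m)%N by lia.
    have h3 : ((n %/ 4).+1 <= 2 * n)%N by lia.
    set Y := (_ * _ * _)%N in tT.
    have YR : Y%:R <= 12 * (m%:R * n%:R ^+ 2) :> R.
      rewrite -natrX -!natrM ler_nat /Y.
      have := leq_mul (leq_mul h1 h2) h3; rewrite expnS expn1; nia.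
    have tR : t%:R <= 1000 * Y%:R :> R by rewrite -natrM ler_nat.
    apply: (le_trans tR); apply: (@le_trans _ _ (12000 * (m%:R * n%:R ^+ 2))).
      by move: YR; set y := Y%:R; set z := _ * _ ^+ 2; lra.
    apply: ler_wpM2l; first exact: ler0n.
    by rewrite ler_peMr// mulr_ge0// exprn_ge0.
split=> //.
(* Existence of V follows by running the program on one state that holds A. *)
pose s0 := State (fun _ k => if k == 0%N then m else n)
  (fun _ l => \sum_(i < m) \sum_(j < n) if l == (i * n + j)%N then A i j else 0).
have inp : input A s0.
  (* Only one term of the double sum survives: division by n shows that row-major addresses are
     distinct. *)
  split=> // i j; rewrite /= (bigD1 i)//= (bigD1 j)//= eqxx big1 ?addr0.
    rewrite big1 ?addr0// => i' i'i; apply: big1 => j' _; rewrite ifF//.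
    apply/negbTE; apply: contra i'i => /eqP e; apply/eqP/val_inj => /=.
    have := congr1 (divn^~ n) e; rewrite /= !divnMDl// !divn_small ?ltn_ord//.
    by rewrite !addn0.
  move=> j' j'j; rewrite ifF// eqn_add2l; apply/negbTE.
  by rewrite eq_sym.
have [V [_ [_ [oV bV _ _ _]]]] := program s0 inp.
by exists V.
Qed.
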